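(* Let $(\bar x,\bar\lambda)=(\bar x^1,\dots,\bar x^N,\bar\lambda^1,\dots,\bar\lambda^N)\in S_{\rm KKT}(\bar p)$ for the quadratic NEP. Suppose that: (i) $I^k_2=\emptyset$ for $k=1,\dots,N$; (ii) $A^k_1$ is of full row rank for $k=1,\dots,N$; (iii) for each player $k$ and any $0\ne y^k\in M^k$, $(y^k)^{\mathrm T}P^k_{n_kn_k}y^k>0$; (iv) there exist parameters $\alpha_{i,j}>0$ ($1\le i,j\le N$, $j\ne i$) with $\sum_{j\ne i}\alpha_{i,j}=1$ for $i=1,\dots,N$, such that, with $T_{ki}:=P^k_{n_kn_i}+(P^i_{n_in_k})^{\mathrm T}$, for all players $i\ne k$ and any $0\ne y^k\in M^k$, $$(y^k)^{\mathrm T}\left(P^k_{n_kn_k}-\frac{1}{4\alpha_{i,k}\alpha_{k,i}}T_{ik}^{\mathrm T}B^i\left((B^i)^{\mathrm T}P^i_{n_in_i}B^i\right)^{-1}(B^i)^{\mathrm T}T_{ik}\right)y^k>0 .$$ Then $S_{\rm KKT}$ has a continuously differentiable single-valued localization around $\bar p$ for $(\bar x,\bar\lambda)$. Moreover, for every $(p,x(p),\lambda(p))\in{\rm gph}\,S_{\rm KKT}$ sufficiently close to $(\bar p,\bar x,\bar\lambda)$, $x(p)$ is a local Nash equilibrium of the quadratic NEP at $p$.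
   Context: Quadratic NEP. There are $N$ players; player $k$ has strategy $x^k\in\mathbb R^{n_k}$; $x=(x^1,\dots,x^N)\in\mathbb R^n$, $n=\sum n_k$. Parameters: $p=(u,v,w)$ with $u^k\in\mathbb R^{m_k}$, $v^k\in\mathbb R^{n_k}$, $w^k\in\mathbb R^{d_k}$. Given the others' strategies $x^{-k}$, player $k$ solves $$\min_{x^k}\ \tfrac12x^{\mathrm T}P^k(w^k)x-\langle c^k(w^k),x\rangle-\langle v^k,x^k\rangle\ \text{ s.t. } a^k_i(w^k)^{\mathrm T}x^k=b^k_i+u^k_i\ (i\le s_k),\ \ a^k_j(w^k)^{\mathrm T}x^k\le b^k_j+u^k_j\ (s_k<j\le m_k),$$ where $P^k(\cdot)\in\mathbb R^{n\times n}$, $c^k(\cdot)\in\mathbb R^n$, $a^k_i(\cdot)\in\mathbb R^{n_k}$ are continuously differentiable around $\bar w^k$, $b^k_i\in\mathbb R$ are constants. The reference parameter is $\bar p=(\bar u,\bar v,\bar w)=(0,0,0)$; write $P^k=P^k(\bar w^k)$, $a^k_i=a^k_i(\bar w^k)$. $P^k$ is symmetric, and $P^k_{n_jn_i}\in\mathbb R^{n_j\times n_i}$ denotes its block with rows corresponding to $x^j$ and columns to $x^i$. A point $x$ is a local Nash equilibrium (LNE) at $p$ if each $x^k$ is a local minimizer of player $k$'s problem given $x^{-k}$ and $p$. KKT mapping: with $L^k(x,\lambda^k;w^k)=\frac12x^{\mathrm T}P^k(w^k)x-\langle c^k(w^k),x\rangle+\sum_{i=1}^{m_k}\lambda^k_i(a^k_i(w^k)^{\mathrm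 T}x^k-b^k_i)$, $S_{\rm KKT}(p)$ is the set of $(x,\lambda)$, $\lambda=(\lambda^1,\dots,\lambda^N)$, $\lambda^k\in\mathbb R^{m_k}$, such that for each $k$: $v^k=\nabla_{x^k}L^k(x,\lambda^k;w^k)$; $a^k_i(w^k)^{\mathrm T}x^k-b^k_i=u^k_i$ for $i\le s_k$; and $\lambda^k_j\ge0$, $a^k_j(w^k)^{\mathrm T}x^k-b^k_j\le u^k_j$, $\lambda^k_j(a^k_j(w^k)^{\mathrm T}x^k-b^k_j-u^k_j)=0$ for $j>s_k$. At $(\bar p,\bar x,\bar\lambda)$: $I^k_1=\{1,\dots,s_k\}\cup\{i>s_k:\bar\lambda^k_i>0=(a^k_i)^{\mathrm T}\bar x^k-b^k_i\}$, $I^k_2=\{i>s_k:\bar\lambda^k_i=0=(a^k_i)^{\mathrm T}\bar x^k-b^k_i\}$. $A^k_1$ is the matrix with rows $(a^k_i)^{\mathrm T}$, $i\in I^k_1$. $M^k=\{y^k\in\mathbb R^{n_k}:(a^k_i)^{\mathrm T}y^k=0\ \forall i\in I^k_1\}$; $B^k$ is a matrix whose columns form a basis of $M^k$. A set-valued mapping $\Phi$ has a continuously differentiable single-valued localization around $\bar a$ for $\bar b$ if $\bar b\in\Phi(\bar a)$ and there are neighborhoods $U$ of $\bar a$, $V$ of $\bar b$ such that ${\rm gph}\,\Phi\cap(U\times V)$ is the graph of a continuously differentiable single-valued mapping $U\to V$. *)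

(* Defs.v *)
From HB Require Import structures.
From mathcomp Require Import all_boot all_order all_algebra.
From mathcomp Require Import all_classical all_reals all_analysis.

Set Implicit Arguments.
Unset Strict Implicit.
Unset Printing Implicit Defensive.

Import Order.TTheory GRing.Theory Num.Theory.
Import numFieldNormedType.Exports.

Local Open Scope classical_set_scope.
Local Open Scope ring_scope.

Section Analysis.
Context {R : realType}.

(* The epsilon clause is continuity at [x] of [y |-> 'd f y] for the operator
   norm on linear maps. *)
Definition C1_on {V W : normedModType R} (U : set V) (f : V -> W) : Prop :=
  forall x, U x -> differentiable f x /\
    forall e : R, 0 < e ->
      \forall y \near x, forall h : V, `|'d f y h - 'd f x h| <= e * `|h|.

Definition C1_around {V W : normedModType R} (f : V -> W) (a : V) : Prop :=
  exists2 U : set V, open_nbhs a U & C1_on U f.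

Definition graph {S T : Type} (Phi : S -> set T) : set (S * T) :=
  [set z | Phi z.1 z.2].

(* [U] is taken open so that differentiability of [f] on [U] only involves the
   values of [f] on [U]; this loses no generality, as any neighborhood can be
   shrunk to its interior. *)
Definition has_C1_localization {V W : normedModType R}
    (Phi : V -> set W) (a : V) (b : W) : Prop :=
  Phi a b /\
  exists (U : set V) (X : set W) (f : V -> W),
    [/\ open_nbhs a U, nbhs b X, C1_on U f, f @` U `<=` X
      & graph Phi `&` (U `*` X) = [set (q, f q) | q in U]].

Definition local_minimizer {T : topologicalType} (D : set T) (f : T -> R)
    (x : T) : Prop :=
  D x /\ \forall z \near x, D z -> f x <= f z.

Definition dotcv {n : nat} (x y : 'cV[R]_n) : R := (x^T *m y) 0 0.

Definition gradient {n : nat} (f : 'cV[R]_n -> R) (x : 'cV[R]_n) : 'cV[R]_n :=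
  \col_(j < n) 'D_(delta_mx j 0) f x.

Definition basis_columns {n r : nat} (M : set 'cV[R]_n) (B : 'M[R]_(n, r)) :=
  row_free B^T /\ M = [set B *m z | z in [set: 'cV[R]_r]].

End Analysis.

(* Data of the quadratic game: player [k : 'I_N] has strategies in R^(n k),
   m k constraints of which the first [eqs k] are equalities, and parameter
   w^k in R^(d k).  Families such as x = (x^1, ..., x^N) are block columns,
   whose k-th block is [submxcol x k]. *)
Record quadratic_game (R : realType) (N : nat) (n m d : 'I_N -> nat) :=
  QuadraticGame {
    eqs : 'I_N -> nat;
    eqs_le : forall k, (eqs k <= m k)%N;
    quad : forall k, 'cV[R]_(d k) -> 'M[R]_(\sum_k n k);
    lin : forall k, 'cV[R]_(d k) -> 'cV[R]_(\sum_k n k);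
    cstr : forall k, 'I_(m k) -> 'cV[R]_(d k) -> 'cV[R]_(n k);
    rhs : forall k, 'I_(m k) -> R
  }.

Section Game.
Context {R : realType} {N : nat} {n m d : 'I_N -> nat}.
Variable G : quadratic_game R n m d.

Notation strategy := 'cV[R]_(\sum_k n k).
Notation multiplier := 'cV[R]_(\sum_k m k).
(* p = (u, v, w) is encoded as ((u, v), w). *)
Notation param :=
  ('cV[R]_(\sum_k m k) * 'cV[R]_(\sum_k n k) * 'cV[R]_(\sum_k d k))%type.

Definition u_of (p : param) (k : 'I_N) : 'cV[R]_(m k) := submxcol p.1.1 k.
Definition v_of (p : param) (k : 'I_N) : 'cV[R]_(n k) := submxcol p.1.2 k.
Definition w_of (p : param) (k : 'I_N) : 'cV[R]_(d k) := submxcol p.2 k.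

Definition is_eq (k : 'I_N) (i : 'I_(m k)) : bool := (i < eqs G k)%N.

Definition deviate (x : strategy) (k : 'I_N) (z : 'cV[R]_(n k)) : strategy :=
  \mxcol_i dfwith (fun j => submxcol x j) k z i.

(* 1/2 x^T P^k(w) x - <c^k(w), x> *)
Definition base_cost (k : 'I_N) (w : 'cV[R]_(d k)) (x : strategy) : R :=
  2^-1 * dotcv x (quad G w *m x) - dotcv (lin G w) x.

Definition cost (p : param) (k : 'I_N) (x : strategy) : R :=
  base_cost (w_of p k) x - dotcv (v_of p k) (submxcol x k).

(* a^k_i(w)^T z - b^k_i *)
Definition slack (k : 'I_N) (w : 'cV[R]_(d k)) (i : 'I_(m k))
    (z : 'cV[R]_(n k)) : R :=
  dotcv (cstr G i w) z - rhs G i.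

Definition feasible (p : param) (k : 'I_N) : set 'cV[R]_(n k) :=
  [set z | forall i : 'I_(m k),
     if is_eq i then slack (w_of p k) i z = u_of p k i 0
     else slack (w_of p k) i z <= u_of p k i 0].

Definition local_Nash (p : param) (x : strategy) : Prop :=
  forall k, local_minimizer (@feasible p k)
              (fun z => cost p k (deviate x z)) (submxcol x k).

Definition lagrangian (k : 'I_N) (x : strategy) (l : 'cV[R]_(m k))
    (w : 'cV[R]_(d k)) : R :=
  base_cost w x + \sum_(i < m k) l i 0 * slack w i (submxcol x k).

Definition S_KKT (p : param) : set (strategy * multiplier) :=
  [set xl | forall k : 'I_N,
     let x := xl.1 in
     let l := submxcol xl.2 k in
     let g := fun i => slack (w_of p k) i (submxcol x k) in
     [/\ v_of p k =
           gradient (fun z => lagrangian (deviate x z) l (w_of p k))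
                    (submxcol x k),
         forall i : 'I_(m k), is_eq i -> g i = u_of p k i 0
       & forall j : 'I_(m k), ~~ is_eq j ->
           [/\ 0 <= l j 0, g j <= u_of p k j 0
             & l j 0 * (g j - u_of p k j 0) = 0]]].

(* Reference parameter wbar = 0. *)
Definition P0 (k : 'I_N) : 'M[R]_(\sum_k n k) := quad G (0 : 'cV[R]_(d k)).
Definition a0 (k : 'I_N) (i : 'I_(m k)) : 'cV[R]_(n k) := cstr G i 0.

(* P^k_{n_j n_i} *)
Definition Pblock (k j i : 'I_N) : 'M[R]_(n j, n i) := submxblock (P0 k) j i.

(* T_{ki} *)
Definition T (k i : 'I_N) : 'M[R]_(n k, n i) := Pblock k k i + (Pblock i i k)^T.

Definition I1 (x : strategy) (l : multiplier) (k : 'I_N) : {set 'I_(m k)} :=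
  finset (fun i => is_eq i ||
    (0 < submxcol l k i 0) && (slack 0 i (submxcol x k) == 0)).

Definition I2 (x : strategy) (l : multiplier) (k : 'I_N) : {set 'I_(m k)} :=
  finset (fun i => [&& ~~ is_eq i, submxcol l k i 0 == 0
    & slack 0 i (submxcol x k) == 0]).

Definition A1 (x : strategy) (l : multiplier) (k : 'I_N) :
    'M[R]_(#|I1 x l k|, n k) :=
  \matrix_(r, j) a0 (enum_val r) j 0.

Definition M (x : strategy) (l : multiplier) (k : 'I_N) : set 'cV[R]_(n k) :=
  [set y | forall i, i \in I1 x l k -> dotcv (a0 i) y = 0].

End Game.

Arguments M {R N n m d} G x l k _.

(* Main.v *)
(* Once the active constraints are fixed, the KKT conditions at parameter p are
   a square linear system in (x, l) whose coefficients depend on w in a C^1 way,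
   so no implicit function theorem is needed: if the system is nonsingular at
   the reference parameter, the inverse matrix gives the C^1 localization, and
   strict complementarity (no active inequality has a zero multiplier) makes
   the system equivalent to the KKT conditions near the reference point.
   Nonsingularity follows from the positivity of
     Q(y) = sum_k <y^k, (P^k y)^k>   on the product of the M^k:
   with the weights alpha, 2 Q is the sum over ordered pairs i <> k of
     alpha_ki q_k(y^k) + alpha_ik q_i(y^i) + <y^i, T_ik y^k>,
   and minimizing over y^i in M^i leaves alpha_ki times the form in (iv).
   For the Nash property, each player's problem is quadratic with linear
   constraints; positivity on M^k persists under perturbation in the penalized
   form h.H h + C sum_i (a_i.h)^2 >= 0 (Finsler), and for small feasible steps h
   the positive multipliers absorb the penalty. *)
Require Import Defs.
From HB Require Import structures.
From mathcomp Require Import all_boot all_order all_algebra.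
From mathcomp Require Import all_classical all_reals all_analysis.
From mathcomp Require Import ring lra.

Set Implicit Arguments.
Unset Strict Implicit.
Unset Printing Implicit Defensive.

Import Order.TTheory GRing.Theory Num.Theory.
Import numFieldNormedType.Exports.

Local Open Scope classical_set_scope.
Local Open Scope ring_scope.


(** * Inner product and unilateral deviations *)

Section DotProduct.
Context {R : realType}.

Lemma dotcvE n (x y : 'cV[R]_n) : dotcv x y = \sum_i x i 0 * y i 0.
Proof. by rewrite /dotcv mxE; apply: eq_bigr => i _; rewrite mxE. Qed.

Lemma dotcvC n (x y : 'cV[R]_n) : dotcv x y = dotcv y x.
Proof. by rewrite !dotcvE; apply: eq_bigr => i _; rewrite mulrC. Qed.

Lemma dotcvDr n (x y z : 'cV[R]_n) : dotcv x (y + z) = dotcv x y + dotcv x z.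
Proof. by rewrite /dotcv mulmxDr mxE. Qed.

Lemma dotcvDl n (x y z : 'cV[R]_n) : dotcv (x + y) z = dotcv x z + dotcv y z.
Proof. by rewrite dotcvC dotcvDr !(dotcvC z). Qed.

Lemma dotcvZr n (x y : 'cV[R]_n) (c : R) : dotcv x (c *: y) = c * dotcv x y.
Proof. by rewrite /dotcv -scalemxAr mxE. Qed.

Lemma dotcvZl n (x y : 'cV[R]_n) (c : R) : dotcv (c *: x) y = c * dotcv x y.
Proof. by rewrite dotcvC dotcvZr dotcvC. Qed.

Lemma dotcv0r n (x : 'cV[R]_n) : dotcv x 0 = 0.
Proof. by rewrite /dotcv mulmx0 mxE. Qed.

Lemma dotcvNr n (x y : 'cV[R]_n) : dotcv x (- y) = - dotcv x y.
Proof. by rewrite -scaleN1r dotcvZr mulN1r. Qed.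

Lemma dotcv_sumr n I (s : seq I) (P : pred I) (x : 'cV[R]_n) (F : I -> 'cV[R]_n) :
  dotcv x (\sum_(i <- s | P i) F i) = \sum_(i <- s | P i) dotcv x (F i).
Proof. by rewrite /dotcv mulmx_sumr summxE. Qed.

Lemma dotcv_suml n I (s : seq I) (P : pred I) (x : 'cV[R]_n) (F : I -> 'cV[R]_n) :
  dotcv (\sum_(i <- s | P i) F i) x = \sum_(i <- s | P i) dotcv (F i) x.
Proof. by rewrite dotcvC dotcv_sumr; apply: eq_bigr => i _; rewrite dotcvC. Qed.

Lemma dotcv_mulmxr n k (x : 'cV[R]_n) (A : 'M[R]_(n, k)) (y : 'cV[R]_k) :
  dotcv x (A *m y) = dotcv (A^T *m x) y.
Proof. by rewrite /dotcv trmx_mul trmxK mulmxA. Qed.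

Lemma dotcv_delta n (x : 'cV[R]_n) j : dotcv x (delta_mx j 0) = x j 0.
Proof.
rewrite dotcvE (bigD1 j)//= mxE !eqxx mulr1 big1 ?addr0// => i ij.
by rewrite mxE (negbTE ij) mulr0.
Qed.

Lemma dotcv_blocks N (n : 'I_N -> nat) (x y : 'cV[R]_(\sum_k n k)) :
  dotcv x y = \sum_k dotcv (submxcol x k) (submxcol y k).
Proof.
rewrite /dotcv -[in LHS](submxcolK x) -[in LHS](submxcolK y).
by rewrite tr_mxcol mul_mxrow_mxcol summxE.
Qed.

Lemma submxcolZ N (n : 'I_N -> nat) (c : R) (x : 'cV[R]_(\sum_k n k)) k :
  submxcol (c *: x) k = c *: submxcol x k.
Proof. by apply/colP => i; rewrite !mxE. Qed.

Lemma submxcol_mulmx N (n : 'I_N -> nat) (A : 'M[R]_(\sum_k n k))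
    (x : 'cV[R]_(\sum_k n k)) k :
  submxcol (A *m x) k = \sum_i submxblock A k i *m submxcol x i.
Proof.
rewrite -submxcol_mul -[in LHS](submxrowK (submxcol A k)) -[in LHS](submxcolK x).
by rewrite mul_mxrow_mxcol; apply: eq_bigr => i _; rewrite submxblockEv.
Qed.

End DotProduct.

Section Deviation.
Context {R : realType} {N : nat} {n : 'I_N -> nat}.
Implicit Types x y : 'cV[R]_(\sum_k n k).

Lemma submxcol_deviate x k (z : 'cV[R]_(n k)) : submxcol (deviate x z) k = z.
Proof. by rewrite /deviate mxcolK dfwithin. Qed.

Lemma submxcol_deviate_neq x k i (z : 'cV[R]_(n k)) :
  k != i -> submxcol (deviate x z) i = submxcol x i.
Proof. by move=> ki; rewrite /deviate mxcolK dfwithout. Qed.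

(** [deviate 0 h] carries [h] in block [k] and zeros elsewhere, so a unilateral change of strategy
    is an additive perturbation and a quadratic cost can be expanded around [x]. *)
Lemma deviateD x k (h : 'cV[R]_(n k)) :
  deviate x (submxcol x k + h) = x + deviate 0 h.
Proof.
apply/mxcolP => i; rewrite submxcolD.
have [<-|ki] := eqVneq k i; first by rewrite !submxcol_deviate.
by rewrite !submxcol_deviate_neq// submxcol0 addr0.
Qed.

Lemma deviate_id x k : deviate x (submxcol x k) = x.
Proof.
apply/mxcolP => i; have [<-|ki] := eqVneq k i; first by rewrite submxcol_deviate.
by rewrite submxcol_deviate_neq.
Qed.

Lemma dotcv_deviate0 x k (h : 'cV[R]_(n k)) :
  dotcv x (deviate 0 h) = dotcv (submxcol x k) h.
Proof.
rewrite dotcv_blocks (bigD1 k)//= submxcol_deviate big1 ?addr0// => i ik.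
by rewrite submxcol_deviate_neq 1?eq_sym// submxcol0 dotcv0r.
Qed.

Lemma quad_deviate0 (A : 'M[R]_(\sum_k n k)) k (h : 'cV[R]_(n k)) :
  dotcv (deviate 0 h) (A *m deviate 0 h) = dotcv h (submxblock A k k *m h).
Proof.
rewrite dotcvC dotcv_deviate0 submxcol_mulmx (bigD1 k)//= submxcol_deviate.
rewrite big1 ?addr0 1?dotcvC// => i ik.
by rewrite submxcol_deviate_neq 1?eq_sym// submxcol0 mulmx0.
Qed.

End Deviation.

(** * Gradients and the explicit KKT conditions *)

Lemma gradient_quadratic (R : realType) n (f : 'cV[R]_n -> R) (x g : 'cV[R]_n)
    (A : 'M[R]_n) :
  (forall h, f (x + h) = f x + dotcv g h + 2^-1 * dotcv h (A *m h)) ->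
  gradient f x = g.
Proof.
move=> fE; apply/colP => j; rewrite mxE.
rewrite /derive; apply: cvg_lim => //.
set v : 'cV[R]_n := delta_mx j 0.
(* The difference quotient of step t along the j-th unit vector v is g_j + (t/2) <v, A v>, which
   tends to g_j. *)
have gcvg : (g j 0 + t * (2^-1 * dotcv v (A *m v))) @[t --> (0 : R)^'] --> g j 0.
  rewrite -[X in _ --> X]addr0 -[X in _ --> _ + X](mul0r (2^-1 * dotcv v (A *m v))).
  apply: cvgD; first exact: cvg_cst.
  by apply: cvgMr_tmp; apply: cvg_within_filter; exact: cvg_id.
apply: cvg_trans gcvg.
apply: near_eq_cvg; near=> t.
have t0 : t != 0 by near: t; exact: nbhs_dnbhs_neq.
rewrite /= [_ + x]addrC fE dotcvZr dotcv_delta -scalemxAr dotcvZr dotcvZl.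
rewrite /GRing.scale/=; field.
Unshelve. all: by end_near. Qed.

Section KKT.
Context {R : realType} {N : nat} {n m d : 'I_N -> nat}.
Variable G : quadratic_game R n m d.
Implicit Types (x : 'cV[R]_(\sum_k n k)) (l : 'cV[R]_(\sum_k m k)).

(** [quad G w] is assumed symmetric only at w = 0; hence the symmetrized matrix with the factor
    1/2. *)
Definition cost_grad k (w : 'cV[R]_(d k)) x : 'cV[R]_(n k) :=
  2^-1 *: submxcol ((quad G w + (quad G w)^T) *m x) k - submxcol (lin G w) k.

Lemma base_cost_deviate k (w : 'cV[R]_(d k)) x (h : 'cV[R]_(n k)) :
  base_cost G w (deviate x (submxcol x k + h)) =
  base_cost G w x + dotcv (cost_grad w x) h
  + 2^-1 * dotcv h (submxblock (quad G w) k k *m h).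
Proof.
set e := deviate 0 h; set Q := quad G w.
have gE : dotcv (cost_grad w x) h
    = 2^-1 * (dotcv x (Q *m e) + dotcv e (Q *m x)) - dotcv (lin G w) e.
  rewrite /cost_grad dotcvDl dotcvZl -scaleN1r dotcvZl mulN1r -!dotcv_deviate0.
  rewrite mulmxDl dotcvDl addrC -/Q -/e [dotcv (Q *m x) e]dotcvC.
  by rewrite -dotcv_mulmxr addrC [X in _ * X]addrC.
rewrite gE deviateD /base_cost -quad_deviate0 mulmxDr !dotcvDr !dotcvDl -/e -/Q.
by field.
Qed.

Lemma slackD k (w : 'cV[R]_(d k)) (i : 'I_(m k)) (z h : 'cV[R]_(n k)) :
  slack G w i (z + h) = slack G w i z + dotcv (cstr G i w) h.
Proof. by rewrite /slack dotcvDr addrAC. Qed.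

Lemma gradient_lagrangian k (w : 'cV[R]_(d k)) x (l : 'cV[R]_(m k)) :
  gradient (fun z => lagrangian G (deviate x z) l w) (submxcol x k) =
  cost_grad w x + \sum_i l i 0 *: cstr G i w.
Proof.
apply: (@gradient_quadratic _ _ _ _ _ (submxblock (quad G w) k k)) => h.
rewrite /lagrangian base_cost_deviate !submxcol_deviate deviate_id.
rewrite dotcvDl dotcv_suml.
under eq_bigr do rewrite slackD mulrDr.
rewrite big_split/= (eq_bigr _ (fun i _ => dotcvZl _ _ _)).
ring.
Qed.

Lemma cost_deviate p k x (h : 'cV[R]_(n k)) :
  cost G p k (deviate x (submxcol x k + h)) =
  cost G p k x + dotcv (cost_grad (w_of p k) x - v_of p k) h
  + 2^-1 * dotcv h (submxblock (quad G (w_of p k)) k k *m h).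
Proof.
rewrite /cost base_cost_deviate submxcol_deviate dotcvDr dotcvDl.
by rewrite -(scaleN1r (v_of p k)) dotcvZl; ring.
Qed.

Lemma S_KKTP p x l : S_KKT G p (x, l) <-> forall k,
  [/\ v_of p k = cost_grad (w_of p k) x
        + \sum_i submxcol l k i 0 *: cstr G i (w_of p k),
      forall i, is_eq G i -> slack G (w_of p k) i (submxcol x k) = u_of p k i 0
    & forall j, ~~ is_eq G j ->
        [/\ 0 <= submxcol l k j 0,
            slack G (w_of p k) j (submxcol x k) <= u_of p k j 0
          & submxcol l k j 0
            * (slack G (w_of p k) j (submxcol x k) - u_of p k j 0) = 0]].
Proof. by split => K k; have := K k; rewrite /= gradient_lagrangian. Qed.

End KKT.

(** * Calculus of continuously differentiable maps *)

Lemma unitmx_of_ker0 (F : fieldType) n (A : 'M[F]_n) :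
  (forall z : 'cV[F]_n, A *m z = 0 -> z = 0) -> A \in unitmx.
Proof.
move=> Ainj; rewrite unitmxE unitfE -det_tr; apply/negP => /det0P[v v0 vA].
move/eqP: v0; apply; apply: trmx_inj; rewrite trmx0; apply: Ainj.
by rewrite -[A]trmxK -trmx_mul vA trmx0.
Qed.

Section OperatorContinuity.
Context {R : realType} {V : normedModType R}.

(* Continuity at [x], for the operator norm, of a map [T] into the linear maps
   from [V] to [W]. *)
Definition opcont {W : normedModType R} (T : V -> V -> W) (x : V) :=
  forall e : R, 0 < e -> \forall y \near x, forall h, `|T y h - T x h| <= e * `|h|.

Lemma opcont_eq {W : normedModType R} (T T' : V -> V -> W) x :
  (\forall y \near x, T y =1 T' y) -> opcont T' x -> opcont T x.
Proof.
move=> TT' cT' e e0; have TT'x := nbhs_singleton TT'.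
near=> y => h; rewrite TT'x (near TT' y)//; move: h.
by near: y; exact: cT'.
Unshelve. all: by end_near. Qed.

Lemma opcontD {W : normedModType R} (T T' : V -> V -> W) x :
  opcont T x -> opcont T' x -> opcont (fun y h => T y h + T' y h) x.
Proof.
move=> cT cT' e e0; have e20 : 0 < e / 2 by rewrite divr_gt0.
near=> y => h; rewrite opprD addrACA (le_trans (ler_normD _ _))//.
rewrite [e]splitr [leRHS]mulrDl lerD//; move: h; near: y; [exact: cT|exact: cT'].
Unshelve. all: by end_near. Qed.

(** The difference splits as c_y (T_y - T_x) + (c_y - c_x) T_x. Near [x] the factor c_y is at most
    |c_x| + 1 in absolute value, and [k] bounds the operator T_x in the second term. *)
Lemma opcont_scale (c : V -> R) (T : V -> V -> R) (x : V) (k : R) :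
  {for x, continuous c} -> opcont T x -> 0 < k ->
  (forall h, `|T x h| <= k * `|h|) -> opcont (fun y h => c y * T y h) x.
Proof.
move=> cc cT k0 Tk e e0.
have c1 : 0 < `|c x| + 1 by rewrite ltr_wpDl.
have d1 : 0 < e / 2 / (`|c x| + 1) by rewrite !divr_gt0.
have d2 : 0 < e / 2 / k by rewrite !divr_gt0.
near=> y => h.
have -> : c y * T y h - c x * T x h
    = c y * (T y h - T x h) + (c y - c x) * T x h by ring.
rewrite (le_trans (ler_normD _ _))// [e]splitr [leRHS]mulrDl !normrM lerD//.
  have : `|T y h - T x h| <= e / 2 / (`|c x| + 1) * `|h|.
    by move: h; near: y; exact: cT.
  have cy : `|c y| <= `|c x| + 1.
    rewrite -[c y](subrK (c x)) (le_trans (ler_normD _ _))// addrC lerD2l.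
    by near: y; apply: cvgr_distC_le cc _ _.
  move=> /(ler_pM (normr_ge0 _) (normr_ge0 _) cy) /le_trans; apply.
  by rewrite mulrA [_ * (_ / _)]mulrC divfK// gt_eqF.
have cy : `|c y - c x| <= e / 2 / k.
  by near: y; apply: cvgr_distC_le cc _ _.
have /le_trans := ler_pM (normr_ge0 _) (normr_ge0 _) cy (Tk h); apply.
by rewrite mulrA divfK// gt_eqF.
Unshelve. all: by end_near. Qed.

End OperatorContinuity.

Section C1Calculus.
Context {R : realType}.

Lemma C1_onS {V W : normedModType R} (U U' : set V) (f : V -> W) :
  U' `<=` U -> C1_on U f -> C1_on U' f.
Proof. by move=> UU' Uf x /UU' /Uf. Qed.

Lemma C1_on_continuous {V W : normedModType R} (U : set V) (f : V -> W) x :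
  C1_on U f -> U x -> {for x, continuous f}.
Proof. by move=> Uf /Uf[/differentiable_continuous]. Qed.

Lemma C1_cst {V W : normedModType R} (U : set V) (c : W) : C1_on U (fun=> c).
Proof.
move=> x Ux; split; first exact: differentiable_cst.
move=> e e0; near=> y => h; rewrite !diff_cst subrr normr0.
by rewrite mulr_ge0// ltW.
Unshelve. all: by end_near. Qed.

(* [U] is open, so that the differential is meaningful near its points. *)
Lemma C1_onI {V W : normedModType R} (U : set V) (f : V -> W) (df : V -> V -> W) :
  open U ->
  (forall x, U x -> differentiable f x /\ 'd f x =1 df x) ->
  (forall x, U x -> opcont df x) -> C1_on U f.
Proof.
move=> oU fU dfU x Ux; split; first by have [] := fU _ Ux.
apply: (opcont_eq (T := fun y => 'd f y)) (dfU _ Ux).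
by near=> y; apply fU; near: y; exact: open_nbhs_nbhs.
Unshelve. all: by end_near. Qed.

Lemma C1_linear_map {V W : normedModType R} (U : set V) (L : V -> W) :
  linear L -> continuous L -> C1_on U L.
Proof.
move=> Llin cL.
pose LM := GRing.isLinear.Build _ _ _ _ _ Llin.
pose L' : {linear _ -> _} := HB.pack L LM.
have dL x : 'd L x = L :> (V -> W) := diff_lin x (cL : continuous L').
move=> x _; split; first exact: linear_differentiable (cL : continuous L').
move=> e e0; near=> y => h; rewrite !dL subrr normr0.
by rewrite mulr_ge0// ltW.
Unshelve. all: by end_near. Qed.

Lemma C1_linear {V W W' : normedModType R} (U : set V) (f : V -> W) (L : W -> W') :
  linear L -> continuous L -> open U -> C1_on U f -> C1_on U (L \o f).
Proof.
move=> Llin cL oU fU.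
pose LM := GRing.isLinear.Build _ _ _ _ _ Llin.
pose L' : {linear _ -> _} := HB.pack L LM.
have [k k0 Lk] := linear_lipschitz (cL : continuous L').
apply: (C1_onI (df := fun x => L \o 'd f x)) => //.
  move=> x /fU[fx _].
  have dL : differentiable L (f x) := linear_differentiable (f x) (cL : continuous L').
  split; first exact: differentiable_comp.
  move=> h; rewrite diff_comp//=; congr (_ _).
  by have -> := diff_lin (f x) (cL : continuous L').
move=> x /fU[_ fx] e e0; near=> y => h.
rewrite /= -[L _ - _](linearB L') (le_trans (Lk _))// mulrC -ler_pdivlMr// mulrAC.
by move: h; near: y; apply: fx; rewrite divr_gt0.
Unshelve. all: by end_near. Qed.

Lemma C1_comp_linear {V V' W : normedModType R} (U : set V) (f : V -> W)
    (L : V' -> V) :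
  linear L -> continuous L -> open U -> C1_on U f -> C1_on (L @^-1` U) (f \o L).
Proof.
move=> Llin cL oU fU.
pose LM := GRing.isLinear.Build _ _ _ _ _ Llin.
pose L' : {linear _ -> _} := HB.pack L LM.
have [k k0 Lk] := linear_lipschitz (cL : continuous L').
apply: (C1_onI (df := fun x => 'd f (L x) \o L)) => //.
- by apply: open_comp => // ? _; exact: cL.
- move=> x /fU[fx _].
  have dL : differentiable L x := linear_differentiable x (cL : continuous L').
  split; first exact: differentiable_comp.
  move=> h; rewrite diff_comp//=; congr (_ _).
  by have -> := diff_lin x (cL : continuous L').
move=> x /fU[_ fx] e e0.
have ek : 0 < e / k by rewrite divr_gt0.
have : \forall y \near x, forall h, `|'d f (L y) h - 'd f (L x) h| <= e / k * `|h|.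
  exact: cL x _ (fx _ ek).
apply: filterS => y yL h.
by rewrite (le_trans (yL _))// -ler_pdivlMl ?divr_gt0// invf_div mulrA divfK ?gt_eqF.
Unshelve. all: by end_near. Qed.

Lemma C1D {V W : normedModType R} (U : set V) (f g : V -> W) :
  open U -> C1_on U f -> C1_on U g -> C1_on U (fun x => f x + g x).
Proof.
move=> oU fU gU; apply: (C1_onI (df := fun x h => 'd f x h + 'd g x h)) => //.
  move=> x Ux; have [fx _] := fU _ Ux; have [gx _] := gU _ Ux.
  split; first exact: differentiableD.
  by move=> h; rewrite (diffD fx gx).
by move=> x Ux; apply: opcontD; [exact: (fU _ Ux).2|exact: (gU _ Ux).2].
Qed.

Lemma C1M {V : normedModType R} (U : set V) (f g : V -> R) :
  open U -> C1_on U f -> C1_on U g -> C1_on U (fun x => f x * g x).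
Proof.
move=> oU fU gU.
apply: (C1_onI (df := fun x h => f x * 'd g x h + g x * 'd f x h)) => //.
  move=> x Ux; have [fx _] := fU _ Ux; have [gx _] := gU _ Ux.
  split; first exact: differentiableM.
  by move=> h; rewrite (diffM fx gx).
move=> x Ux; have [fx dfx] := fU _ Ux; have [gx dgx] := gU _ Ux.
have [k k0 fk] := linear_lipschitz (diff_continuous fx).
have [k' k'0 gk] := linear_lipschitz (diff_continuous gx).
apply: opcontD.
  by apply: opcont_scale k'0 gk => //; exact: differentiable_continuous.
by apply: opcont_scale k0 fk => //; exact: differentiable_continuous.
Qed.

Lemma C1V {V : normedModType R} (U : set V) (f : V -> R) :
  open U -> (forall x, U x -> f x != 0) -> C1_on U f -> C1_on U (fun x => (f x)^-1).
Proof.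
move=> oU f0 fU.
apply: (C1_onI (df := fun x h => - (f x) ^- 2 * 'd f x h)) => //.
  move=> x Ux; have [fx _] := fU _ Ux; have fx0 := f0 _ Ux.
  split; first exact: differentiableV.
  by move=> h; rewrite (diffV fx fx0).
move=> x Ux; have [fx dfx] := fU _ Ux; have fx0 := f0 _ Ux.
have [k k0 fk] := linear_lipschitz (diff_continuous fx).
apply: opcont_scale k0 fk => //.
apply: continuousN; apply: continuousV; first by rewrite expf_neq0.
apply: (@continuous_comp _ _ _ f (fun t : R => t ^+ 2)).
  exact: differentiable_continuous.
exact: exprn_continuous.
Qed.

Lemma C1_sum {V W : normedModType R} (U : set V) I (s : seq I) (P : pred I)
    (f : I -> V -> W) :
  open U -> (forall i, C1_on U (f i)) -> C1_on U (fun x => \sum_(i <- s | P i) f i x).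
Proof.
move=> oU fU; elim: s => [|i s IH].
  have -> : (fun x => \sum_(i <- [::] | P i) f i x) = fun=> 0.
    by apply/funext => x; rewrite big_nil.
  exact: C1_cst.
case: (boolP (P i)) => Pi; last first.
  by under eq_fun do rewrite big_cons (negbTE Pi).
by under eq_fun do rewrite big_cons Pi; exact: C1D.
Qed.

Lemma C1_prod {V : normedModType R} (U : set V) I (s : seq I) (P : pred I)
    (f : I -> V -> R) :
  open U -> (forall i, C1_on U (f i)) -> C1_on U (fun x => \prod_(i <- s | P i) f i x).
Proof.
move=> oU fU; elim: s => [|i s IH].
  have -> : (fun x => \prod_(i <- [::] | P i) f i x) = fun=> 1.
    by apply/funext => x; rewrite big_nil.
  exact: C1_cst.
case: (boolP (P i)) => Pi; last first.
  by under eq_fun do rewrite big_cons (negbTE Pi).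
by under eq_fun do rewrite big_cons Pi; exact: C1M.
Qed.

(** A matrix is the finite sum of its entries times elementary matrices, and each entry is a
    continuous linear function of it. This reduces matrix-valued maps to sums and products of scalar
    ones. *)
Lemma C1_mxP {V : normedModType R} (U : set V) p q (f : V -> 'M[R]_(p, q)) :
  open U -> (forall i j, C1_on U (fun x => f x i j)) <-> C1_on U f.
Proof.
move=> oU; split => [fU|fU i j]; last first.
  apply: (C1_linear (L := fun A : 'M[R]_(p, q) => A i j)) => //.
    by move=> a u v; rewrite !mxE.
  exact: coord_continuous.
have -> : f = fun x => \sum_i \sum_j f x i j *: delta_mx i j.
  by apply/funext => x; exact: matrix_sum_delta.
apply: C1_sum => // i; apply: C1_sum => // j.
apply: (C1_linear (L := fun a : R => a *: (delta_mx i j : 'M[R]_(p, q)))) => //.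
  by move=> a u v; rewrite scalerDl -scalerA.
exact: scalel_continuous.
Qed.

Lemma C1_det {V : normedModType R} (U : set V) q (A : V -> 'M[R]_q) :
  open U -> C1_on U A -> C1_on U (fun x => \det (A x)).
Proof.
move=> oU /C1_mxP AU; apply: C1_sum => // s; apply: C1M => //; first exact: C1_cst.
by apply: C1_prod => // i; exact: AU.
Qed.

(** Cramer's rule: the entries are cofactors divided by the determinant. This formula stands in for
    [invmx], which is defined by cases. *)
Lemma C1_invmx {V : normedModType R} (U : set V) q (A : V -> 'M[R]_q) :
  open U -> (forall x, U x -> \det (A x) != 0) -> C1_on U A ->
  C1_on U (fun x => (\det (A x))^-1 *: \adj (A x)).
Proof.
move=> oU A0 AU; apply/C1_mxP => // i j; under eq_fun do rewrite !mxE.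
apply: C1M => //; first by apply: C1V => //; exact: C1_det.
apply: C1M => //; first exact: C1_cst.
apply: C1_det => //; apply/C1_mxP => // k l; under eq_fun do rewrite !mxE.
by move/C1_mxP : AU; exact.
Qed.

Lemma C1_mulmx {V : normedModType R} (U : set V) p q r (A : V -> 'M[R]_(p, q))
    (B : V -> 'M[R]_(q, r)) :
  open U -> C1_on U A -> C1_on U B -> C1_on U (fun x => A x *m B x).
Proof.
move=> oU /C1_mxP AU /C1_mxP BU; apply/C1_mxP => // i j.
under eq_fun do rewrite mxE.
by apply: C1_sum => // k; apply: C1M => //; [exact: AU|exact: BU].
Qed.

(** In the standard basis [F p] is a matrix K(p) with C^1 entries. Injectivity at [a] makes det K(a)
    nonzero, continuity keeps it nonzero nearby, and there the unique solution is K(p)^-1 g(p). *)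
Lemma linear_solve_C1 {V : normedModType R} q (F : V -> 'cV[R]_q -> 'cV[R]_q)
    (g : V -> 'cV[R]_q) (U : set V) (a : V) :
  open_nbhs a U -> (forall p, linear (F p)) -> (forall z, C1_on U (F ^~ z)) ->
  C1_on U g -> (forall z, F a z = 0 -> z = 0) ->
  exists (U' : set V) (f : V -> 'cV[R]_q),
    [/\ open_nbhs a U', C1_on U' f &
        forall p, U' p -> forall z, F p z = g p <-> z = f p].
Proof.
move=> [oU Ua] Flin FU gU Finj.
pose K p : 'M[R]_q := \matrix_(i, j) F p (delta_mx j 0) i 0.
have FK p z : F p z = K p *m z.
  pose FM := GRing.isLinear.Build _ _ _ _ _ (Flin p).
  pose F' : {linear _ -> _} := HB.pack (F p) FM.
  have FZ b v : F p (b *: v) = b *: F p v by exact: (linearZ_LR F').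
  rewrite [z in LHS]matrix_sum_delta.
  under [in LHS]eq_bigr do rewrite big_ord1.
  rewrite [LHS](linear_sum F'); apply/colP => i; rewrite mxE summxE.
  apply: eq_bigr => j _; rewrite [F' _]FZ !mxE; exact: mulrC.
have KU : C1_on U K.
  apply/C1_mxP => // i j; under eq_fun do rewrite mxE.
  by have /C1_mxP := FU (delta_mx j 0); exact.
have Ka : \det (K a) != 0.
  rewrite -unitfE -unitmxE; apply: unitmx_of_ker0 => z Kz.
  by apply: Finj; rewrite FK.
have Knear : \forall p \near a, \det (K p) != 0.
  have /cvgr_neq0 := C1_on_continuous (C1_det oU KU) Ua; exact.
pose U' := (U `&` [set p | \det (K p) != 0])^°.
have U'U : U' `<=` U by move=> p /interior_subset[].
have U'K p : U' p -> \det (K p) != 0 by move=> /interior_subset[].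
exists U', (fun p => ((\det (K p))^-1 *: \adj (K p)) *m g p); split.
- split; first exact: open_interior.
  by apply: filterI Knear; exact: open_nbhs_nbhs.
- apply: C1_mulmx; [exact: open_interior| |exact: C1_onS gU].
  by apply: C1_invmx; [exact: open_interior|by []|exact: C1_onS KU].
move=> p /U'K Kp z; rewrite FK.
have Ku : K p \in unitmx by rewrite unitmxE unitfE.
have -> : (\det (K p))^-1 *: \adj (K p) = invmx (K p) by rewrite /invmx Ku.
by split => [<-|->]; rewrite ?mulKmx ?mulKVmx.
Qed.

End C1Calculus.

(** * Positivity of the coupled quadratic form *)

Section Positivity.
Context {R : realType}.

Lemma quad_symD n (S : 'M[R]_n) (z c : 'cV[R]_n) : S^T = S ->
  dotcv (z + c) (S *m (z + c))
  = dotcv z (S *m z) + 2 * dotcv z (S *m c) + dotcv c (S *m c).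
Proof.
move=> Ssym; rewrite mulmxDr !dotcvDr !dotcvDl.
by rewrite [dotcv c (S *m z)]dotcv_mulmxr Ssym [dotcv (S *m c) z]dotcvC; ring.
Qed.

(* The left-hand side is minimal over the range of [B] at
   [z = - (2 a)^-1 *: invmx (B^T *m P *m B) *m B^T *m t]. *)
Lemma range_quad_lower_bound n r (P : 'M[R]_n) (B : 'M[R]_(n, r))
    (t : 'cV[R]_n) (z : 'cV[R]_r) (a : R) :
  P^T = P -> 0 < a ->
  (forall z : 'cV[R]_r, z != 0 -> 0 < dotcv (B *m z) (P *m (B *m z))) ->
  - (4 * a)^-1 * dotcv t (B *m invmx (B^T *m P *m B) *m B^T *m t)
  <= a * dotcv (B *m z) (P *m (B *m z)) + dotcv (B *m z) t.
Proof.
move=> Psym a0 Bpos; set S := B^T *m P *m B.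
have SE u : dotcv (B *m u) (P *m (B *m u)) = dotcv u (S *m u).
  by rewrite [RHS]dotcvC -!mulmxA -{1}[B]trmxK -dotcv_mulmxr dotcvC.
have Spos u : u != 0 -> 0 < dotcv u (S *m u) by move=> /Bpos; rewrite SE.
have Sge0 u : 0 <= dotcv u (S *m u).
  have [->|/Spos/ltW//] := eqVneq u 0; by rewrite mulmx0 dotcv0r.
have Ssym : S^T = S by rewrite /S !trmx_mul trmxK Psym mulmxA.
have Su : S \in unitmx.
  apply: unitmx_of_ker0 => u Su0; apply/eqP/negPn/negP => /Spos.
  by rewrite Su0 dotcv0r ltxx.
set c := invmx S *m (B^T *m t).
have Sc : S *m c = B^T *m t by rewrite /c mulKVmx.
have -> : B *m invmx S *m B^T *m t = B *m c by rewrite /c !mulmxA.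
have -> : dotcv t (B *m c) = dotcv c (S *m c) by rewrite dotcv_mulmxr Sc dotcvC.
have -> : dotcv (B *m z) t = dotcv z (S *m c).
  by rewrite Sc dotcvC dotcv_mulmxr dotcvC.
rewrite SE -subr_ge0.
(* Completing the square: the form of [S] is nonnegative at the displacement of [z] from the
   minimizer - c / (2a), and [a] times its expansion is the difference of the two sides. *)
have := mulr_ge0 (ltW a0) (Sge0 (z + (2 * a)^-1 *: c)).
rewrite quad_symD// -!scalemxAr !dotcvZr !dotcvZl.
congr (0 <= _); by field; rewrite gt_eqF.
Qed.

Variables (N : nat) (n r : 'I_N -> nat) (A : 'I_N -> 'M[R]_(\sum_k n k)).
Variables (B : forall k, 'M[R]_(n k, r k)) (alpha : 'I_N -> 'I_N -> R).

(** For [A := P0 G] these two unfold to [Pblock] and [T]. *)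
Let Ablock k j i : 'M[R]_(n j, n i) := submxblock (A k) j i.
Let cross k i : 'M[R]_(n k, n i) := Ablock k k i + (Ablock i i k)^T.

Hypothesis Asym : forall k, (A k)^T = A k.
Hypothesis Bpos : forall k (z : 'cV[R]_(r k)), z != 0 ->
  0 < dotcv (B k *m z) (Ablock k k k *m (B k *m z)).
Hypothesis alpha_gt0 : forall i j, j != i -> 0 < alpha i j.
Hypothesis alpha_sum : forall i, \sum_(j | j != i) alpha i j = 1.
Hypothesis schur_pos : forall i k, i != k -> forall z : 'cV[R]_(r k), B k *m z != 0 ->
  0 < dotcv (B k *m z) ((Ablock k k k - (4 * alpha i k * alpha k i)^-1 *:
    ((cross i k)^T *m B i *m invmx ((B i)^T *m Ablock i i i *m B i)
     *m (B i)^T *m cross i k)) *m (B k *m z)).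

(* Distributing each diagonal term over the other players with the weights
   [alpha] splits twice the total into the sum over ordered pairs of players
   of the forms [pair], each of which is controlled by its Schur complement. *)
Lemma coupled_quad_pos (y : 'cV[R]_(\sum_k n k)) :
  (forall k, exists z, submxcol y k = B k *m z) -> y != 0 ->
  0 < \sum_k dotcv (submxcol y k) (submxcol (A k *m y) k).
Proof.
move=> yB y0; pose Y k := submxcol y k.
pose q k i := dotcv (Y k) (Ablock k k i *m Y i).
pose pair k i := alpha k i * q k k + alpha i k * q i i + (q i k + q k i).
have qcross i k : dotcv (Y i) (cross i k *m Y k) = q i k + q k i.
  rewrite mulmxDl dotcvDr [dotcv _ (_^T *m _)]dotcv_mulmxr trmxK.
  by rewrite [dotcv _ (Y k)]dotcvC.
have Ablock_sym k : (Ablock k k k)^T = Ablock k k k.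
  by rewrite /Ablock tr_submxblock Asym.
have q_ge0 k : 0 <= q k k.
  have [z yz] := yB k; rewrite /q /Y yz.
  have [->|/Bpos/ltW//] := eqVneq z 0; by rewrite !mulmx0 dotcv0r.
have pair_gt0 k i : i != k -> Y k != 0 -> 0 < pair k i.
  move=> ik Yk0; have aki := alpha_gt0 ik.
  have aik : 0 < alpha i k by apply: alpha_gt0; rewrite eq_sym.
  have [z yz] := yB i; have [z' yz'] := yB k.
  (* Player i's own form with weight [alpha i k], plus the linear term given by [cross i k *m Y k],
     is bounded below over the range of [B i]. *)
  have := range_quad_lower_bound (cross i k *m Y k) z (Ablock_sym i) aik (@Bpos i).
  rewrite -yz -/(Y i) qcross -/(q i i).
  have := schur_pos ik (z := z'); rewrite -yz' -/(Y k) => /(_ Yk0).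
  rewrite mulmxBl dotcvDr dotcvNr -/(q k k) -scalemxAl dotcvZr.
  rewrite -!mulmxA [dotcv (Y k) ((cross i k)^T *m _)]dotcv_mulmxr trmxK.
  set D := dotcv _ _ => qD1 qD2.
  (* Multiplying the Schur condition by [alpha k i] cancels that weight in the denominator and
     leaves the constant 1 / (4 alpha_ik) of the lower bound. *)
  have : 0 < alpha k i * (q k k - (4 * alpha i k * alpha k i)^-1 * D).
    by rewrite mulr_gt0.
  have -> : alpha k i * (q k k - (4 * alpha i k * alpha k i)^-1 * D)
     = alpha k i * q k k + - (4 * alpha i k)^-1 * D.
    by field; rewrite !gt_eqF.
  by rewrite /pair; lra.
have pair_ge0 k i : i != k -> 0 <= pair k i.
  (* If [Y k] vanishes, the pair reduces to [alpha i k * q i i]. *)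
  move=> ik; have [Yk0|/(pair_gt0 _ _ ik)/ltW//] := eqVneq (Y k) 0.
  have aik : 0 < alpha i k by apply: alpha_gt0; rewrite eq_sym.
  rewrite /pair -qcross {1}/q Yk0 !mulmx0 !dotcv0r mulr0 add0r addr0.
  by rewrite mulr_ge0// ltW.
(* As the weights of each player sum to 1, every diagonal term is collected twice, once from each
   position in the ordered pair; every cross term also occurs twice. *)
have total : 2 * \sum_k dotcv (Y k) (submxcol (A k *m y) k)
    = \sum_k \sum_(i | i != k) pair k i.
  have -> : \sum_k dotcv (Y k) (submxcol (A k *m y) k)
      = \sum_k q k k + \sum_k \sum_(i | i != k) q k i.
    rewrite -big_split; apply: eq_bigr => k _ /=.
    by rewrite submxcol_mulmx dotcv_sumr (bigD1 k).
  have off : \sum_k \sum_(i | i != k) q i k = \sum_k \sum_(i | i != k) q k i.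
    rewrite (exchange_big_dep xpredT)//=; apply: eq_bigr => k _.
    by apply: eq_bigl => i; rewrite eq_sym.
  have diag1 : \sum_k \sum_(i | i != k) alpha k i * q k k = \sum_k q k k.
    by apply: eq_bigr => k _; rewrite -mulr_suml alpha_sum mul1r.
  have diag2 : \sum_k \sum_(i | i != k) alpha i k * q i i = \sum_k q k k.
    rewrite -[RHS]diag1 (exchange_big_dep xpredT)//=; apply: eq_bigr => k _.
    by apply: eq_bigl => i; rewrite eq_sym.
  under [in RHS]eq_bigr do rewrite !big_split/=.
  by rewrite !big_split/= off diag1 diag2; ring.
have [k Yk0] : exists k, Y k != 0.
  apply: contrapT => none; move/eqP: y0; apply; apply/mxcolP => k.
  by rewrite submxcol0; apply/eqP/negPn/negP => Yk0; apply: none; exists k.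
(* A second player exists, since otherwise the weights of player k would form an empty sum, equal to
   0 instead of 1. *)
have [i ik] : exists i, i != k.
  apply: contrapT => none; have := alpha_sum k.
  rewrite big_pred0 => [/esym/eqP|i]; first by rewrite oner_eq0.
  by apply/negbTE/negP => ik; apply: none; exists i.
rewrite -(pmulr_rgt0 _ (ltr0n R 2)) total (bigD1 k)//= (bigD1 i)//=.
rewrite -addrA ltr_pwDl ?pair_gt0// addr_ge0// sumr_ge0// => j.
  by move=> /andP[jk _]; exact: pair_ge0.
by move=> _; rewrite sumr_ge0// => j' ?; exact: pair_ge0.
Qed.

End Positivity.

(** * Finsler's lemma *)

(** The norm is the maximum of the absolute values of the entries, so this is the boundary of a
    cube. It contains a positive multiple of every nonzero vector. *)
Lemma unit_sphere_compact (R : realType) n : compact [set v : 'rV[R]_n | `|v| = 1].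
Proof.
apply: bounded_closed_compact.
  by exists 1; split => // M M1 v /= ->; exact: ltW.
have -> : [set v : 'rV[R]_n | `|v| = 1]
    = (Num.norm : 'rV[R]_n -> R) @^-1` [set 1] by [].
apply: closed_comp; last exact: closed_eq.
by move=> v _; exact: norm_continuous.
Qed.

Lemma cvg_dotcv (R : realType) n T (F : set_system T) {FF : Filter F}
    (u v : T -> 'cV[R]_n) (u0 v0 : 'cV[R]_n) :
  (forall i, u t i 0 @[t --> F] --> u0 i 0) ->
  (forall i, v t i 0 @[t --> F] --> v0 i 0) ->
  dotcv (u t) (v t) @[t --> F] --> dotcv u0 v0.
Proof.
move=> uF vF; under eq_fun do rewrite dotcvE.
by rewrite dotcvE; apply: (cvg_big add_continuous) => i _; apply: cvgM.
Qed.

Lemma cvg_mulmx_col (R : realType) n k T (F : set_system T) {FF : Filter F}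
    (A : T -> 'M[R]_(n, k)) (v : T -> 'cV[R]_k) (A0 : 'M[R]_(n, k)) (v0 : 'cV[R]_k) :
  (forall i j, A t i j @[t --> F] --> A0 i j) ->
  (forall i, v t i 0 @[t --> F] --> v0 i 0) ->
  forall i, (A t *m v t) i 0 @[t --> F] --> (A0 *m v0) i 0.
Proof.
move=> AF vF i; under eq_fun do rewrite mxE.
by rewrite mxE; apply: (cvg_big add_continuous) => j _; apply: cvgM.
Qed.

(** At a unit vector, either the penalty is positive and dominates for large [C], or it vanishes and
    the form is positive by hypothesis. Both cases persist for nearby vectors and parameters;
    compactness of the sphere makes [C] and the neighborhood uniform, and homogeneity of degree 2
    reaches every [h]. *)
Lemma perturbed_finsler (R : realType) (V : topologicalType) n (I : finType)
    (J : pred I) (H : V -> 'M[R]_n) (a : I -> V -> 'cV[R]_n) (p0 : V) :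
  (forall i j, {for p0, continuous (fun p => H p i j)}) ->
  (forall i j, {for p0, continuous (fun p => a i p j 0)}) ->
  (forall y : 'cV[R]_n, y != 0 -> (forall i, J i -> dotcv (a i p0) y = 0) ->
     0 < dotcv y (H p0 *m y)) ->
  exists2 C : R, 0 < C & \forall p \near p0, forall h,
    0 <= dotcv h (H p *m h) + C * \sum_(i | J i) dotcv (a i p) h ^+ 2.
Proof.
move=> cH ca Hpos.
pose q p (v : 'rV[R]_n) := dotcv v^T (H p *m v^T).
pose s p (v : 'rV[R]_n) := \sum_(i | J i) dotcv (a i p) v^T ^+ 2.
have s_ge0 p v : 0 <= s p v by apply: sumr_ge0 => i _; exact: sqr_ge0.
pose bound (t : R * V) v := 0 < q t.2 v + t.1 * s t.2 v.
(* The pair (C, p) follows the product of the filters C -> +oo and p -> p0, so that compactness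
   gives uniformity in both at once. *)
have cover : \forall t \near filter_prod +oo_R (nbhs p0),
    [set v : 'rV[R]_n | `|v| = 1] `<=` bound t.
  have /compact_near_coveringP := @unit_sphere_compact R n; apply.
  move=> v0 /= v01; pose Phi := filter_prod (nbhs v0) (filter_prod +oo_R (nbhs p0)).
  suff : \forall t \near Phi, bound t.2 t.1 by [].
  have cv2 : t.2.2 @[t --> Phi] --> p0.
    exact: (cvg_comp _ _ cvg_snd cvg_snd).
  have cv1 j : t.1^T j 0 @[t --> Phi] --> v0^T j 0.
    have -> : (fun t : 'rV[R]_n * (R * V) => t.1^T j 0)
        = (fun v : 'rV[R]_n => v 0 j) \o fst.
      by apply/funext => t; rewrite mxE.
    by rewrite mxE; apply: (cvg_comp _ _ cvg_fst); exact: coord_continuous.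
  have qcvg : q t.2.2 t.1 @[t --> Phi] --> q p0 v0.
    apply: cvg_dotcv => //; apply: cvg_mulmx_col => // i j.
    exact: cvg_comp _ _ cv2 (cH i j).
  have scvg : s t.2.2 t.1 @[t --> Phi] --> s p0 v0.
    apply: (cvg_big add_continuous) => i _; under eq_fun do rewrite expr2; rewrite expr2.
    have dcvg : dotcv (a i t.2.2) t.1^T @[t --> Phi] --> dotcv (a i p0) v0^T.
      by apply: cvg_dotcv => // j; exact: cvg_comp _ _ cv2 (ca i j).
    exact: cvgM.
  have Clarge C : \forall t \near Phi, C < t.2.1.
    have c21 : t.2.1 @[t --> Phi] --> +oo_R.
      exact: (cvg_comp _ _ cvg_snd cvg_fst).
    exact: (c21 _ (nbhs_pinfty_gt (num_real C))).
  have [s0|s0] := eqVneq (s p0 v0) 0.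
    have q0 : 0 < q p0 v0.
      apply: Hpos => [|i Ji].
        apply/eqP => /(congr1 trmx); rewrite trmxK trmx0 => v00.
        by move: v01; rewrite v00 normr0 => /esym/eqP; rewrite oner_eq0.
      have sq_ge0 j : J j -> 0 <= dotcv (a j p0) v0^T ^+ 2 by rewrite sqr_ge0.
      by apply/eqP; rewrite -sqrf_eq0; apply/eqP; exact: (psumr_eq0P sq_ge0 s0).
    near=> t; rewrite /bound ltr_pwDl//; first by near: t; exact: cvgr_gt qcvg _ q0.
    by rewrite mulr_ge0// ltW//; near: t; exact: Clarge.
  have {}s0 : 0 < s p0 v0 by rewrite lt_def s0 s_ge0.
  near=> t; rewrite /bound.
  have st : s p0 v0 / 2 < s t.2.2 t.1.
    by near: t; apply: cvgr_gt scvg _ _; rewrite ltr_pdivrMr// ltr_pMr// ltr1n.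
  have qt : q p0 v0 - 1 < q t.2.2 t.1.
    by near: t; apply: cvgr_gt qcvg _ _; rewrite ltrBlDr ltrDl.
  (* Above this threshold, and with the penalty above half its limit, the penalty term exceeds |q| +
     1, while the form stays above q - 1; their sum is positive. *)
  have Ct : (`|q p0 v0| + 1) / (s p0 v0 / 2) < t.2.1 by near: t; exact: Clarge.
  have C0 : 0 < t.2.1.
    by apply: le_lt_trans Ct; rewrite divr_ge0// ?addr_ge0// ltW// divr_gt0.
  have : `|q p0 v0| + 1 < t.2.1 * s t.2.2 t.1.
    apply: (@lt_trans _ _ (t.2.1 * (s p0 v0 / 2))); last by rewrite ltr_pM2l.
    by rewrite -ltr_pdivrMr// divr_gt0.
  by have := ler_norm (- q p0 v0); rewrite normrN; lra.
have [[/= X Y] [[M [_ MX]] p0Y] XYcover] := cover.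
(* [X] contains every real above [M]; the absolute value makes [C] positive. *)
pose C := `|M| + 1.
exists C; first by rewrite ltr_wpDl.
have XC : X C by apply: MX; rewrite /C (le_lt_trans (ler_norm M))// ltrDl.
apply: filterS p0Y => p Yp h.
have [->|h0] := eqVneq h 0.
  rewrite mulmx0 dotcv0r add0r mulr_ge0// ?addr_ge0//.
  by apply: sumr_ge0 => i _; exact: sqr_ge0.
have N0 : 0 < `|h^T|.
  by rewrite normr_gt0; apply: contra_neq h0 => /(congr1 trmx); rewrite trmxK trmx0.
(* Rescaling [h] to the unit sphere multiplies both terms by [c ^+ 2]. *)
set c := `|h^T|^-1; have c0 : 0 < c by rewrite invr_gt0.
have := XYcover (C, p) (conj XC Yp) (c *: h^T) => /=.
rewrite normrZ gtr0_norm// mulVf ?gt_eqF// => /(_ erefl).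
have hc : (c *: h^T)^T = c *: h by rewrite linearZ/= trmxK.
rewrite /bound /q /s /= hc -scalemxAr dotcvZr dotcvZl.
under eq_bigr do rewrite dotcvZr exprMn.
rewrite -mulr_sumr; set X1 := dotcv h _; set X2 := \sum_(i | _) _ => /ltW.
have -> : c * (c * X1) + C * (c ^+ 2 * X2) = c ^+ 2 * (X1 + C * X2) by ring.
by rewrite pmulr_rge0// exprn_gt0.
Unshelve. all: by end_near. Qed.

(** * The KKT system for a fixed active set *)

Section C1Blocks.
Context {R : realType}.

Lemma mx_continuous (T : topologicalType) p q (f : T -> 'M[R]_(p, q)) :
  (forall i j, continuous (fun t => f t i j)) -> continuous f.
Proof.
move=> fc; have -> : f = fun t => \sum_i \sum_j f t i j *: delta_mx i j.
  by apply/funext => t; exact: matrix_sum_delta.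
move=> t; apply: (cvg_big add_continuous) => i _.
apply: (cvg_big add_continuous) => j _.
exact: (cvg_comp _ _ (fc i j t) (@scalel_continuous _ _ (delta_mx i j) _)).
Qed.

Lemma submxcol_continuous N (n : 'I_N -> nat) q k :
  continuous (fun A : 'M[R]_(\sum_k n k, q) => submxcol A k).
Proof.
apply: mx_continuous => i j.
have -> : (fun A : 'M[R]_(\sum_k n k, q) => submxcol A k i j)
    = fun A => A (tagnat.Rank k i) j by apply/funext => A; rewrite mxE.
exact: coord_continuous.
Qed.

Lemma cvg_submxcol_entry N (n : 'I_N -> nat) (T : Type) (F : set_system T)
    {FF : Filter F} (f : T -> 'cV[R]_(\sum_k n k)) (a : 'cV[R]_(\sum_k n k)) k i :
  f t @[t --> F] --> a -> submxcol (f t) k i 0 @[t --> F] --> submxcol a k i 0.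
Proof.
move=> fa; have ga := cvg_comp _ _ fa (@submxcol_continuous _ n 1 k a).
exact: (cvg_comp _ _ ga (@coord_continuous _ _ _ i 0 (submxcol a k))).
Qed.

Lemma C1_col_mx {V : normedModType R} (U : set V) p1 p2 q (f : V -> 'M[R]_(p1, q))
    (g : V -> 'M[R]_(p2, q)) :
  open U -> C1_on U f -> C1_on U g -> C1_on U (fun x => col_mx (f x) (g x)).
Proof.
move=> oU /C1_mxP fU /C1_mxP gU; apply/C1_mxP => // i j.
by under eq_fun do rewrite mxE; case: (fintype.split i) => k; [exact: fU|exact: gU].
Qed.

Lemma C1_usubmx {V : normedModType R} (U : set V) p1 p2 q
    (f : V -> 'M[R]_(p1 + p2, q)) :
  open U -> C1_on U f -> C1_on U (fun x => usubmx (f x)).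
Proof.
move=> oU /C1_mxP fU; apply/C1_mxP => // i j; under eq_fun do rewrite mxE.
exact: fU.
Qed.

Lemma C1_dsubmx {V : normedModType R} (U : set V) p1 p2 q
    (f : V -> 'M[R]_(p1 + p2, q)) :
  open U -> C1_on U f -> C1_on U (fun x => dsubmx (f x)).
Proof.
move=> oU /C1_mxP fU; apply/C1_mxP => // i j; under eq_fun do rewrite mxE.
exact: fU.
Qed.

Lemma C1_mxcol {V : normedModType R} (U : set V) N (n : 'I_N -> nat) q
    (f : forall k, V -> 'M[R]_(n k, q)) :
  open U -> (forall k, C1_on U (f k)) -> C1_on U (fun x => \mxcol_k f k x).
Proof.
move=> oU fU; apply/C1_mxP => // i j; under eq_fun do rewrite mxE.
by have /C1_mxP := fU (tagnat.sig1 i); exact.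
Qed.

Lemma C1_submxcol {V : normedModType R} (U : set V) N (n : 'I_N -> nat) q
    (f : V -> 'M[R]_(\sum_k n k, q)) k :
  open U -> C1_on U f -> C1_on U (fun x => submxcol (f x) k).
Proof.
move=> oU /C1_mxP fU; apply/C1_mxP => // i j; under eq_fun do rewrite mxE.
exact: fU.
Qed.

Lemma C1_col {V : normedModType R} (U : set V) q (f : 'I_q -> V -> R) :
  open U -> (forall i, C1_on U (f i)) -> C1_on U (fun x => \col_i f i x).
Proof.
by move=> oU fU; apply/C1_mxP => // i j; under eq_fun do rewrite mxE; exact: fU.
Qed.

Lemma C1_dotcv {V : normedModType R} (U : set V) q (f g : V -> 'cV[R]_q) :
  open U -> C1_on U f -> C1_on U g -> C1_on U (fun x => dotcv (f x) (g x)).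
Proof.
move=> oU /C1_mxP fU /C1_mxP gU; under eq_fun do rewrite dotcvE.
by apply: C1_sum => // i; apply: C1M => //; [exact: fU|exact: gU].
Qed.

Lemma C1_scalemx {V : normedModType R} (U : set V) p q (f : V -> 'M[R]_(p, q))
    (c : R) :
  open U -> C1_on U f -> C1_on U (fun x => c *: f x).
Proof.
move=> oU /C1_mxP fU; apply/C1_mxP => // i j; under eq_fun do rewrite mxE.
by apply: C1M => //; [exact: C1_cst|exact: fU].
Qed.

Lemma C1_trmx {V : normedModType R} (U : set V) p q (f : V -> 'M[R]_(p, q)) :
  open U -> C1_on U f -> C1_on U (fun x => (f x)^T).
Proof.
move=> oU /C1_mxP fU; apply/C1_mxP => // i j; under eq_fun do rewrite mxE.
exact: fU.
Qed.

(** The pair is the sum of the images of [f] and [g] under the two coordinate embeddings, which are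
    linear and continuous. *)
Lemma C1_pair {V W W' : normedModType R} (U : set V) (f : V -> W) (g : V -> W') :
  open U -> C1_on U f -> C1_on U g -> C1_on U (fun x => (f x, g x)).
Proof.
move=> oU fU gU.
have -> : (fun x => (f x, g x)) = fun x => (f x, 0) + (0, g x).
  by apply/funext => x; congr pair; rewrite ?addr0 ?add0r.
apply: C1D => //.
  apply: (C1_linear (L := fun y : W => (y, 0 : W'))) => //.
    by move=> a u v; congr pair; rewrite /= scaler0 addr0.
  by move=> y; apply: cvg_pair; [exact: cvg_id|exact: cvg_cst].
apply: (C1_linear (L := fun y : W' => (0 : W, y))) => //.
  by move=> a u v; congr pair; rewrite /= scaler0 addr0.
by move=> y; apply: cvg_pair; [exact: cvg_cst|exact: cvg_id].
Qed.

(** [C1_on] over a singleton is the property at one point; in this form the conditions on finitely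
    many maps can be intersected inside a neighborhood filter. *)
Lemma C1_around_near {V W : normedModType R} (f : V -> W) a :
  C1_around f a -> \forall x \near a, C1_on [set x] f.
Proof.
move=> [U /open_nbhs_nbhs aU fU]; apply: filterS aU => x Ux y ->.
exact: fU.
Qed.

Lemma C1_around_continuous {V W : normedModType R} (f : V -> W) a :
  C1_around f a -> {for a, continuous f}.
Proof. by move=> [U [_ Ua] fU]; exact: C1_on_continuous fU Ua. Qed.

End C1Blocks.

(** Continuity at z = x, where the product vanishes. With [e] proportional to a positive multiplier,
    this limits the steps considered in the second-order argument. *)
Lemma oppr_dotcv_near_le (R : realType) n (a x : 'cV[R]_n) (e : R) :
  0 < e -> \forall z \near x, - dotcv a (z - x) <= e.
Proof.
move=> e0.
have cv : dotcv a (z - x) @[z --> nbhs x] --> dotcv a 0.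
  apply: cvg_dotcv => j; first exact: cvg_cst.
  have -> : (fun z : 'cV[R]_n => (z - x) j 0) = fun z => z j 0 - x j 0.
    by apply/funext => z; rewrite !mxE.
  rewrite mxE -(subrr (x j 0)).
  by apply: cvgB; [exact: coord_continuous|exact: cvg_cst].
near=> z; rewrite lerNl; near: z; apply: cvgr_ge cv _ _.
by rewrite dotcv0r oppr_lt0.
Unshelve. all: by end_near. Qed.

(** * Linear KKT system, strict complementarity and second-order sufficiency *)

Section KKTSystem.
Context {R : realType} {N : nat} {n m d : 'I_N -> nat}.
Variable G : quadratic_game R n m d.

Notation strategy := 'cV[R]_(\sum_k n k).
Notation multiplier := 'cV[R]_(\sum_k m k).
Notation param :=
  ('cV[R]_(\sum_k m k) * 'cV[R]_(\sum_k n k) * 'cV[R]_(\sum_k d k))%type.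
Implicit Types (p : param) (x : strategy) (l : multiplier).

Lemma u_of_linear k : linear (fun p : param => u_of p k).
Proof. by move=> a u v; apply/colP => i; rewrite !mxE. Qed.

Lemma v_of_linear k : linear (fun p : param => v_of p k).
Proof. by move=> a u v; apply/colP => i; rewrite !mxE. Qed.

Lemma w_of_linear k : linear (fun p : param => w_of p k).
Proof. by move=> a u v; apply/colP => i; rewrite !mxE. Qed.

Lemma u_of_continuous k : continuous (fun p : param => u_of p k).
Proof.
move=> p; apply: (cvg_comp _ _ (cvg_comp _ _ cvg_fst cvg_fst)).
exact: submxcol_continuous.
Qed.

Lemma v_of_continuous k : continuous (fun p : param => v_of p k).
Proof.
move=> p; apply: (cvg_comp _ _ (cvg_comp _ _ cvg_fst cvg_snd)).
exact: submxcol_continuous.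
Qed.

Lemma w_of_continuous k : continuous (fun p : param => w_of p k).
Proof.
by move=> p; apply: (cvg_comp _ _ cvg_snd); exact: submxcol_continuous.
Qed.

Lemma w_of0 k : w_of (0 : param) k = 0.
Proof. exact: submxcol0. Qed.

Lemma C1_w_of {W : normedModType R} k (f : 'cV[R]_(d k) -> W) :
  C1_around f 0 -> C1_around (fun p : param => f (w_of p k)) 0.
Proof.
move=> [U [oU U0] fU]; exists ((fun p : param => w_of p k) @^-1` U).
  split; last by rewrite /= w_of0.
  by apply: open_comp => // p _; exact: w_of_continuous.
by apply: C1_comp_linear fU => //; [exact: w_of_linear|exact: w_of_continuous].
Qed.

(** A candidate for the set of active constraints, kept fixed while the parameter varies; it becomes
    [I1] at the reference point. *)
Variable J : forall k, {set 'I_(m k)}.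

(* A constraint outside [J] contributes the row [l^k_i = 0], which makes the
   system square. *)
Definition kkt_op p (z : 'cV[R]_(\sum_k n k + \sum_k m k)) :
    'cV[R]_(\sum_k n k + \sum_k m k) :=
  col_mx
    (\mxcol_k (2^-1 *: submxcol ((quad G (w_of p k) + (quad G (w_of p k))^T)
                                 *m usubmx z) k
               + \sum_i submxcol (dsubmx z) k i 0 *: cstr G i (w_of p k)))
    (\mxcol_k \col_i (if i \in J k
       then dotcv (cstr G i (w_of p k)) (submxcol (usubmx z) k)
       else submxcol (dsubmx z) k i 0)).

Definition kkt_rhs p : 'cV[R]_(\sum_k n k + \sum_k m k) :=
  col_mx (\mxcol_k (v_of p k + submxcol (lin G (w_of p k)) k))
         (\mxcol_k \col_i (if i \in J k then rhs G i + u_of p k i 0 else 0)).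

Lemma kkt_op_linear p : linear (kkt_op p).
Proof.
move=> a u v; rewrite /kkt_op scale_col_mx add_col_mx; congr col_mx.
  apply/mxcolP => k; rewrite submxcolD submxcolZ !mxcolK.
  rewrite [usubmx _]linearP /= mulmxDr -scalemxAr submxcolD submxcolZ.
  rewrite [dsubmx _]linearP/= [RHS]addrC.
  have -> : \sum_i submxcol (a *: dsubmx u + dsubmx v) k i 0 *: cstr G i (w_of p k)
    = a *: (\sum_i submxcol (dsubmx u) k i 0 *: cstr G i (w_of p k))
      + \sum_i submxcol (dsubmx v) k i 0 *: cstr G i (w_of p k).
    rewrite scaler_sumr -big_split; apply: eq_bigr => i _.
    by rewrite !mxE scalerDl scalerA.
  by rewrite !scalerDr !scalerA [2^-1 * a]mulrC addrACA [RHS]addrC.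
apply/mxcolP => k; rewrite submxcolD submxcolZ !mxcolK.
apply/colP => i; rewrite !mxE; case: ifP => _.
  by rewrite [usubmx _]linearP/= submxcolD submxcolZ dotcvDr dotcvZr.
by [].
Qed.

Lemma kkt_opP p x l : kkt_op p (col_mx x l) = kkt_rhs p <->
  [/\ forall k, v_of p k = cost_grad G (w_of p k) x
        + \sum_i submxcol l k i 0 *: cstr G i (w_of p k),
      forall k i, i \in J k -> slack G (w_of p k) i (submxcol x k) = u_of p k i 0
    & forall k i, i \notin J k -> submxcol l k i 0 = 0].
Proof.
rewrite /kkt_op /kkt_rhs col_mxKu col_mxKd; split.
  move=> /eq_col_mx[/eq_mxcolP E1 /eq_mxcolP E2]; split.
  - by move=> k; rewrite /cost_grad addrAC E1 addrK.
  - move=> k i iJ; have /colP/(_ i) := E2 k.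
    by rewrite !mxE iJ /slack => ->; rewrite addrAC subrr add0r.
  - by move=> k i iJ; have /colP/(_ i) := E2 k; rewrite !mxE (negbTE iJ).
move=> [E1 E2 E3]; congr col_mx; apply/eq_mxcolP => k.
  by rewrite E1 /cost_grad addrAC subrK.
apply/colP => i; rewrite [LHS]mxE [RHS]mxE; case: ifPn => [/E2|/E3//].
by rewrite /slack => <-; rewrite addrC subrK.
Qed.

(** Strict complementarity relative to [J]. Beyond the membership of equalities in [J], which does
    not involve the point, only strict inequalities occur; this makes the condition stable near the
    reference point. *)
Definition strict_active p x l := forall k (i : 'I_(m k)),
  if is_eq G i then i \in J k
  else if i \in J k then 0 < submxcol l k i 0
  else slack G (w_of p k) i (submxcol x k) < u_of p k i 0.

(** In each complementarity product strictness makes one factor nonzero, so the other vanishes.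
    Conversely, the strict signs supply the inequalities that the linear system leaves out. *)
Lemma S_KKT_strict_active p x l : strict_active p x l ->
  S_KKT G p (x, l) <-> kkt_op p (col_mx x l) = kkt_rhs p.
Proof.
move=> act; rewrite S_KKTP kkt_opP; split => [K|[E1 E2 E3] k]; split.
- by move=> k; have [] := K k.
- move=> k i iJ; have [_ Keq Kin] := K k; have := act k i.
  case: ifPn => [/Keq//|ieq]; rewrite iJ => l0.
  have [_ _ /eqP] := Kin _ ieq.
  by rewrite mulf_eq0 gt_eqF//= subr_eq0 => /eqP.
- move=> k i iJ; have [_ Keq Kin] := K k; have := act k i.
  case: ifPn => [_|ieq]; rewrite (negbTE iJ)// => lt.
  have [_ _ /eqP] := Kin _ ieq.
  by rewrite mulf_eq0 subr_eq0 (lt_eqF lt) orbF => /eqP.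
- exact: E1.
- by move=> i ieq; apply: E2; have := act k i; rewrite ieq.
- move=> i ieq; have := act k i; rewrite (negbTE ieq).
  case: ifPn => [iJ l0|iJ lt]; first by rewrite E2// subrr mulr0 ltW.
  by rewrite E3// mul0r lexx (ltW lt).
Qed.

(** By stationarity the cost changes by - sum_J l_i t_i + (1/2) <h, H h> with t_i = <a_i, h>, and
    the penalized bound gives (1/2) <h, H h> >= - (C/2) sum_J t_i^2. For small feasible steps each
    (C/2) t_i^2 is at most - l_i t_i. *)
Lemma S_KKT_second_order p x l k (C : R) : S_KKT G p (x, l) ->
  strict_active p x l -> 0 < C ->
  (forall h, 0 <= dotcv h (submxblock (quad G (w_of p k)) k k *m h)
     + C * \sum_(i | i \in J k) dotcv (cstr G i (w_of p k)) h ^+ 2) ->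
  local_minimizer (@feasible _ _ _ _ _ G p k)
    (fun z => cost G p k (deviate x z)) (submxcol x k).
Proof.
move=> K act C0 finsler; set xk := submxcol x k; set w := w_of p k.
have [_ Eact Eina] := (kkt_opP p x l).1 ((S_KKT_strict_active act).1 K).
have [Ev Keq Kin] := (S_KKTP G p x l).1 K k.
split.
  by move=> i; case: ifPn => [/Keq//|/Kin[]].
(* With t = <a_i, z - xk> <= 0, the bound - t <= 2 l_i / C is what yields (C/2) t^2 <= - l_i t. *)
pose small i z := i \in J k -> ~~ is_eq G i ->
  - dotcv (cstr G i w) (z - xk) <= 2 / C * submxcol l k i 0.
have small_near : \forall z \near xk, forall i, small i z.
  apply: (@filter_forall _ _ small (nbhs xk)) => i; rewrite /small.
  have [/andP[iJ ieq]|] := boolP ((i \in J k) && ~~ is_eq G i); last first.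
    by move=> h; near=> z => iJ ieq; rewrite iJ ieq in h.
  have l0 : 0 < submxcol l k i 0 by have := act k i; rewrite (negbTE ieq) iJ.
  have := @oppr_dotcv_near_le _ _ (cstr G i w) xk (2 / C * submxcol l k i 0).
  by rewrite mulr_gt0 ?divr_gt0// => /(_ isT); apply: filterS.
near=> z => feas; have smallz : forall i, small i z by near: z.
set h := z - xk.
have zE : z = xk + h by rewrite addrC subrK.
rewrite deviate_id {1}zE cost_deviate -addrA lerDl.
(* Stationarity turns the first-order term of the cost into a combination of constraint normals. *)
have -> : cost_grad G w x - v_of p k = - \sum_i submxcol l k i 0 *: cstr G i w.
  by rewrite Ev opprD addNKr.
rewrite dotcvC dotcvNr dotcv_sumr.
have sumJ : \sum_i dotcv h (submxcol l k i 0 *: cstr G i w)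
    = \sum_(i | i \in J k) submxcol l k i 0 * dotcv (cstr G i w) h.
  rewrite big_mkcond [RHS]big_mkcond/=; apply: eq_bigr => i _.
  by case: ifPn => [|/Eina->]; rewrite dotcvZr dotcvC// mul0r.
rewrite sumJ.
have lin_ge : C / 2 * \sum_(i | i \in J k) dotcv (cstr G i w) h ^+ 2
    <= - \sum_(i | i \in J k) submxcol l k i 0 * dotcv (cstr G i w) h.
  rewrite mulr_sumr -sumrN; apply: ler_sum => i iJ.
  (* The constraint is tight at [xk], so feasibility of [z] gives t = 0 for an equality and t <= 0
     for an inequality. *)
  have := feas i; have := Eact k i iJ; rewrite zE slackD -/w -/xk => ->.
  have := smallz i.
  rewrite /small; move: (act k i).
  case: ifPn => [_ _ _ /eqP|ieq]; last rewrite iJ.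
    by rewrite -subr_eq0 addrAC subrr add0r => /eqP->; rewrite expr0n/= !mulr0 oppr0.
  move=> l0 /(_ isT isT); rewrite -/h gerDl; set t := dotcv _ h => sm t0.
  have {}sm : C / 2 * - t <= submxcol l k i 0.
    by rewrite -ler_pdivlMl ?divr_gt0// invf_div.
  have t0' : 0 <= - t by rewrite oppr_ge0.
  by have := ler_wpM2r t0' sm; rewrite expr2; lra.
have := finsler h; lra.
Unshelve. all: by end_near. Qed.

End KKTSystem.

(** * Persistence of smoothness and strict activity near the reference point *)

Section Regularity.
Context {R : realType} {N : nat} {n m d : 'I_N -> nat}.
Variable G : quadratic_game R n m d.

Notation strategy := 'cV[R]_(\sum_k n k).
Notation multiplier := 'cV[R]_(\sum_k m k).
Notation param :=
  ('cV[R]_(\sum_k m k) * 'cV[R]_(\sum_k n k) * 'cV[R]_(\sum_k d k))%type.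
Implicit Types (p : param) (x : strategy) (l : multiplier).

Variable J : forall k, {set 'I_(m k)}.

Hypothesis quadC1 : forall k, C1_around (quad G (k:=k)) 0.
Hypothesis linC1 : forall k, C1_around (lin G (k:=k)) 0.
Hypothesis cstrC1 : forall k (i : 'I_(m k)), C1_around (cstr G i) 0.

Lemma C1_kkt (U : set param) : open U ->
  (forall k, C1_on U (fun p => quad G (w_of p k))) ->
  (forall k, C1_on U (fun p => lin G (w_of p k))) ->
  (forall k (i : 'I_(m k)), C1_on U (fun p => cstr G i (w_of p k))) ->
  (forall z, C1_on U (fun p => kkt_op G J p z)) /\ C1_on U (kkt_rhs G J).
Proof.
move=> oU QU cU aU.
have uU k : C1_on U (fun p : param => u_of p k).
  by apply: C1_linear_map; [exact: u_of_linear|exact: u_of_continuous].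
have vU k : C1_on U (fun p : param => v_of p k).
  by apply: C1_linear_map; [exact: v_of_linear|exact: v_of_continuous].
split=> [z|]; apply: (C1_col_mx oU); apply: (C1_mxcol oU) => k.
- apply: (C1D oU).
    apply: (C1_scalemx _ oU); apply: (C1_submxcol _ oU); apply: (C1_mulmx oU).
      by apply: (C1D oU); [exact: QU|apply: (C1_trmx oU); exact: QU].
    exact: C1_cst.
  by apply: (C1_sum _ _ oU) => i; apply: (C1_scalemx _ oU); exact: aU.
- apply: (C1_col oU) => i.
  case: (i \in J k); last exact: C1_cst.
  by apply: (C1_dotcv oU); [exact: aU|exact: C1_cst].
- by apply: (C1D oU); [exact: vU|apply: (C1_submxcol _ oU); exact: cU].
- apply: (C1_col oU) => i.
  case: (i \in J k); last exact: C1_cst.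
  apply: (C1D oU); first exact: C1_cst.
  exact: (C1_mxP _ oU).2 (uU k) i 0.
Qed.

Lemma kkt_near : exists2 U : set param, open_nbhs (0 : param) U &
  (forall z, C1_on U (fun p => kkt_op G J p z)) /\ C1_on U (kkt_rhs G J).
Proof.
(* The property is pointwise and involves finitely many maps, so it holds near 0; the interior of
   the set where it holds is an open neighborhood on which all the data are C^1. *)
pose regular p := [/\ forall k, C1_on [set p] (fun p : param => quad G (w_of p k)),
  forall k, C1_on [set p] (fun p : param => lin G (w_of p k))
  & forall k (i : 'I_(m k)), C1_on [set p] (fun p : param => cstr G i (w_of p k))].
have reg0 : \forall p \near (0 : param), regular p.
  have Q0 : \forall p \near (0 : param),
      forall k, C1_on [set p] (fun p : param => quad G (w_of p k)).
    exact: filter_forall _ (fun k => C1_around_near (C1_w_of (quadC1 k))).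
  have c0 : \forall p \near (0 : param),
      forall k, C1_on [set p] (fun p : param => lin G (w_of p k)).
    exact: filter_forall _ (fun k => C1_around_near (C1_w_of (linC1 k))).
  have a0 : \forall p \near (0 : param),
      forall k (i : 'I_(m k)), C1_on [set p] (fun p : param => cstr G i (w_of p k)).
    exact: filter_forall _ (fun k => filter_forall _ (fun i =>
      C1_around_near (C1_w_of (@cstrC1 k i)))).
  by apply: filterS (filterI Q0 (filterI c0 a0)) => p [? [? ?]]; split.
have oU : open [set p | regular p]^° by exact: open_interior.
exists [set p | regular p]^°; first by split.
by apply: C1_kkt => // k; [| |move=> i] => p /interior_subset[h1 h2 h3];
  [exact: h1|exact: h2|exact: h3].
Unshelve. all: by end_near. Qed.

(** There are finitely many strict inequalities, each between quantities continuous at the reference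
    point. *)
Lemma strict_active_near x l : strict_active G J 0 x l ->
  \forall z \near ((0, (x, l)) : param * (strategy * multiplier)),
    strict_active G J z.1 z.2.1 z.2.2.
Proof.
move=> act; pose active k (i : 'I_(m k)) (z : param * (strategy * multiplier)) :=
  if is_eq G i then i \in J k
  else if i \in J k then 0 < submxcol z.2.2 k i 0
  else slack G (w_of z.1 k) i (submxcol z.2.1 k) < u_of z.1 k i 0.
suff near_active k i :
    \forall z \near ((0, (x, l)) : param * (strategy * multiplier)), active k i z.
  exact: filter_forall _ (fun k => filter_forall _ (fun i => near_active k i)).
pose z0 : param * (strategy * multiplier) := (0, (x, l)).
have pc : z.1 @[z --> z0] --> (0 : param) by exact: cvg_fst.
have xc : z.2.1 @[z --> z0] --> x by exact: (cvg_comp _ _ cvg_snd cvg_fst).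
have lc : z.2.2 @[z --> z0] --> l by exact: (cvg_comp _ _ cvg_snd cvg_snd).
have uc : z.1.1.1 @[z --> z0] --> (0 : multiplier).
  exact: (cvg_comp _ _ pc (cvg_comp _ _ cvg_fst cvg_fst)).
rewrite /active; have := act k i; case: ifPn => [_ iJ|_].
  by apply: filterE => z.
case: ifPn => [_ l0|_].
  exact: cvgr_gt (cvg_submxcol_entry lc) _ l0.
rewrite -subr_lt0 => lt.
have sc : slack G (w_of z.1 k) i (submxcol z.2.1 k) - u_of z.1 k i 0 @[z --> z0]
    --> slack G (w_of (0 : param) k) i (submxcol x k) - u_of (0 : param) k i 0.
  apply: cvgB; last exact: cvg_submxcol_entry uc.
  apply: cvgB; last exact: cvg_cst.
  apply: cvg_dotcv => j; last exact: cvg_submxcol_entry xc.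
  have ac := cvg_comp _ _ pc (C1_around_continuous (C1_w_of (@cstrC1 k i))).
  exact: (cvg_comp _ _ ac (@coord_continuous _ _ _ j 0 _)).
near=> z; rewrite -subr_lt0; near: z; exact: cvgr_lt _ sc _ lt.
Unshelve. all: by end_near. Qed.

End Regularity.

(** * Nonsingularity and strict complementarity at the reference point *)

Section Nondegeneracy.
Context {R : realType} {N : nat} {n m d : 'I_N -> nat}.
Variable G : quadratic_game R n m d.

Notation strategy := 'cV[R]_(\sum_k n k).
Notation multiplier := 'cV[R]_(\sum_k m k).
Notation param :=
  ('cV[R]_(\sum_k m k) * 'cV[R]_(\sum_k n k) * 'cV[R]_(\sum_k d k))%type.

(** For a kernel element (y, mu), pairing the stationarity rows with the blocks of y gives zero,
    because y is orthogonal to the constraint normals in [J] and mu vanishes outside [J]. Positivity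
    then forces y = 0, and independence of the normals forces mu = 0. *)
Lemma kkt_op0_inj (J : forall k, {set 'I_(m k)}) :
  (forall k, (P0 G k)^T = P0 G k) ->
  (forall k (mu : 'cV[R]_(m k)), (forall i, i \notin J k -> mu i 0 = 0) ->
     \sum_i mu i 0 *: a0 G i = 0 -> mu = 0) ->
  (forall y : strategy,
     (forall k i, i \in J k -> dotcv (a0 G i) (submxcol y k) = 0) -> y != 0 ->
     0 < \sum_k dotcv (submxcol y k) (submxcol (P0 G k *m y) k)) ->
  forall z, kkt_op G J (0 : param) z = 0 -> z = 0.
Proof.
move=> Qsym indep pos z; rewrite -[z]vsubmxK /kkt_op col_mxKu col_mxKd.
set y := usubmx z; set mu := dsubmx z.
move/eqP; rewrite col_mx_eq0 => /andP[/eqP E1 /eqP E2].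
have {}E2 k : forall i, if i \in J k then dotcv (a0 G i) (submxcol y k) = 0
    else submxcol mu k i 0 = 0.
  move=> i; have := congr1 (fun A => submxcol A k i 0) E2.
  by rewrite mxcolK submxcol0 [LHS]mxE [RHS]mxE w_of0; case: ifP.
(* By symmetry at the reference parameter, half the sum of the matrix and its transpose is [P0 G k]
   itself. *)
have {}E1 k : submxcol (P0 G k *m y) k = - \sum_i submxcol mu k i 0 *: a0 G i.
  have := congr1 (fun A => submxcol A k) E1.
  rewrite mxcolK submxcol0 w_of0 -/(P0 G k) Qsym mulmxDl submxcolD => /eqP.
  rewrite addr_eq0 -mulr2n -[submxcol _ k *+ 2]scaler_nat scalerA.
  by rewrite mulVf ?pnatr_eq0// scale1r => /eqP.
have y0 : y = 0.
  apply/eqP/negPn/negP => /pos; rewrite big1 ?ltxx => [H|k _].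
    by have := H (fun k i iJ => ltac:(have := E2 k i; rewrite iJ; exact)).
  rewrite E1 dotcvNr dotcv_sumr big1 ?oppr0// => i _; rewrite dotcvZr.
  by have := E2 k i; case: ifP => _ E; rewrite ?E ?mul0r// dotcvC E mulr0.
have mu0 : mu = 0.
  apply/mxcolP => k; rewrite submxcol0; apply: indep => [i iJ|].
    by have := E2 k i; rewrite (negbTE iJ).
  by apply: oppr_inj; rewrite oppr0 -E1 y0 mulmx0 submxcol0.
by rewrite y0 mu0 col_mx0.
Qed.

(** The coefficients are supported on [I1]; enumerated as a row vector, they annihilate the rows of
    [A1], which are independent. *)
Lemma active_cstr_indep (x : strategy) (l : multiplier) k (mu : 'cV[R]_(m k)) :
  row_free (A1 G x l k) -> (forall i, i \notin I1 G x l k -> mu i 0 = 0) ->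
  \sum_i mu i 0 *: a0 G i = 0 -> mu = 0.
Proof.
move=> A1free muJ mua0; pose c : 'rV[R]_#|I1 G x l k| := \row_r mu (enum_val r) 0.
have cA : c *m A1 G x l k = 0.
  apply/rowP => j; rewrite !mxE; have /colP/(_ j) := mua0.
  rewrite summxE mxE (bigID (mem (I1 G x l k)))/= [X in _ + X]big1; last first.
    by move=> i /muJ->; rewrite scale0r mxE.
  rewrite addr0 big_enum_val/= => E; rewrite -[RHS]E.
  by apply: eq_bigr => r _; rewrite !mxE.
have c0 : c = 0 by apply/eqP; rewrite -(mulmx_free_eq0 _ A1free) cA.
apply/colP => i; rewrite mxE; have [iJ|/muJ//] := boolP (i \in I1 G x l k).
have /rowP/(_ (enum_rank_in iJ i)) := c0.
by rewrite !mxE enum_rankK_in.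
Qed.

(** An inequality outside [I1] with zero slack has a multiplier that is nonnegative but not
    positive, hence zero; it would then belong to the empty set [I2]. *)
Lemma I1_strict_active (x : strategy) (l : multiplier) :
  S_KKT G 0 (x, l) -> (forall k, I2 G x l k = finset.set0) ->
  strict_active G (I1 G x l) 0 x l.
Proof.
move=> /S_KKTP K I20 k i; have [_ _ Kin] := K k.
rewrite inE; case: (boolP (is_eq G i)) => //= ieq.
have [l0 su cs] := Kin _ ieq; move: su cs.
have -> : u_of (0 : param) k i 0 = 0 by rewrite /u_of submxcol0 mxE.
rewrite w_of0 subr0 => su cs.
have /negbT := finset.in_set0 i; rewrite -(I20 k) inE ieq/= => nI2.
case: ifPn => [/andP[]//|nI1]; rewrite lt_neqAle su andbT; apply/negP => s0.
by move: nI1 nI2; rewrite s0 !andbT lt_def l0 andbT negbK => ->.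
Qed.

End Nondegeneracy.

(** * Construction of the localization and the Nash property *)

Theorem proposition6p2 (R : realType) (N : nat) (n m d r : 'I_N -> nat)
  (G : quadratic_game R n m d)
  (hP : forall k, C1_around (quad G (k:=k)) 0)
  (hc : forall k, C1_around (lin G (k:=k)) 0)
  (ha : forall k (i : 'I_(m k)), C1_around (cstr G i) 0)
  (hsym : forall k, (P0 G k)^T = P0 G k)
  (x : 'cV[R]_(\sum_k n k)) (l : 'cV[R]_(\sum_k m k))
  (hKKT : S_KKT G 0 (x, l))
  (B : forall k, 'M[R]_(n k, r k))
  (hB : forall k, basis_columns (M G x l k) (B k))
  (hI2 : forall k, I2 G x l k = finset.set0)
  (hA1 : forall k, row_free (A1 G x l k))
  (hiii : forall k (y : 'cV[R]_(n k)), y != 0 -> M G x l k y ->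
     0 < dotcv y (Pblock G k k k *m y))
  (hiv : exists alpha : 'I_N -> 'I_N -> R,
     [/\ forall i j, j != i -> 0 < alpha i j,
         forall i, \sum_(j | j != i) alpha i j = 1
       & forall i k, i != k -> forall y : 'cV[R]_(n k), y != 0 -> M G x l k y ->
           0 < dotcv y
             ((Pblock G k k k
               - (4 * alpha i k * alpha k i)^-1 *:
                 ((T G i k)^T *m B i
                  *m invmx ((B i)^T *m Pblock G i i i *m B i)
                  *m (B i)^T *m T G i k)) *m y)]) :
  has_C1_localization (S_KKT G) 0 (x, l) /\
  \forall z \near ((0, (x, l)) :
      ('cV[R]_(\sum_k m k) * 'cV[R]_(\sum_k n k) * 'cV[R]_(\sum_k d k)) *
      ('cV[R]_(\sum_k n k) * 'cV[R]_(\sum_k m k))),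
    graph (S_KKT G) z -> local_Nash G z.1 z.2.1.
Proof.
pose param :=
  ('cV[R]_(\sum_k m k) * 'cV[R]_(\sum_k n k) * 'cV[R]_(\sum_k d k))%type.
pose J := I1 G x l.
have act : strict_active G J 0 x l by exact: I1_strict_active.
have MB k z : M G x l k (B k *m z).
  by have [_ ->] := hB k; exists z.
have BM k y : M G x l k y -> exists z, y = B k *m z.
  by have [_ ->] := hB k => -[z _ <-]; exists z.
have Binj k (z : 'cV[R]_(r k)) : z != 0 -> B k *m z != 0.
  have [Bfree _] := hB k; apply: contra_neq => Bz; apply: trmx_inj.
  by apply/eqP; rewrite trmx0 -(mulmx_free_eq0 _ Bfree) -trmx_mul Bz trmx0.
(* Full row rank handles the multipliers. Conditions (iii) and (iv), read on the ranges of the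
   [B k], give the positivity that handles the strategies. *)
have inj z : kkt_op G J (0 : param) z = 0 -> z = 0.
  apply: kkt_op0_inj => // [k mu|y yM y0].
    exact: active_cstr_indep.
  have [alpha [alpha0 alpha1 schur]] := hiv.
  apply: (@coupled_quad_pos _ _ _ _ (P0 G) B alpha) => //.
  - by move=> k z' z'0; apply: hiii; [exact: Binj|exact: MB].
  - by move=> i k ik z' z'0; apply: schur.
  - by move=> k; apply: BM => i; exact: yM.
have actnear := strict_active_near ha act.
split; last first.
  (* Condition (iii) is perturbed player by player; finitely many players share a neighborhood of
     0. *)
  have finsler : \forall p \near (0 : param), forall k, exists2 C : R, 0 < C &
      forall h, 0 <= dotcv h (submxblock (quad G (w_of p k)) k k *m h)
        + C * \sum_(i | i \in J k) dotcv (cstr G i (w_of p k)) h ^+ 2.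
    suff H k : \forall p \near (0 : param), exists2 C : R, 0 < C &
        forall h, 0 <= dotcv h (submxblock (quad G (w_of p k)) k k *m h)
          + C * \sum_(i | i \in J k) dotcv (cstr G i (w_of p k)) h ^+ 2.
      exact: filter_forall _ H.
    have [||y y0 yJ|C C0 HC] := @perturbed_finsler R param (n k) _
      (mem (J k)) (fun p => submxblock (quad G (w_of p k)) k k)
      (fun i p => cstr G i (w_of p k)) 0.
    + move=> i j; have -> : (fun p : param => submxblock (quad G (w_of p k)) k k i j)
        = fun p => quad G (w_of p k) (tagnat.Rank k i) (tagnat.Rank k j).
        by apply/funext => p; rewrite mxE.
      have Qc := C1_around_continuous (C1_w_of (n := n) (m := m) (hP k)).
      exact: (cvg_comp _ _ Qc (@coord_continuous _ _ _ _ _ _)).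
    + move=> i j.
      have ac := C1_around_continuous (C1_w_of (n := n) (m := m) (@ha k i)).
      exact: (cvg_comp _ _ ac (@coord_continuous _ _ _ j 0 _)).
    + rewrite w_of0; apply: hiii => // i iJ; have := yJ i iJ.
      by rewrite w_of0.
    + by apply: filterS HC => p HC; exists C.
  have finsler' : \forall z \near ((0, (x, l)) : param *
        ('cV[R]_(\sum_k n k) * 'cV[R]_(\sum_k m k))), forall k, exists2 C : R, 0 < C &
      forall h, 0 <= dotcv h (submxblock (quad G (w_of z.1 k)) k k *m h)
        + C * \sum_(i | i \in J k) dotcv (cstr G i (w_of z.1 k)) h ^+ 2.
    exact: cvg_fst finsler.
  apply: filterS2 finsler' actnear => z finslerz az K k.
  have [C C0 HC] := finslerz k.
  by apply: (S_KKT_second_order _ az C0 HC); rewrite -surjective_pairing.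
split=> //.
have [[/= U0 X0] [U00 X0xl] U0X0] := actnear.
have [U1 U1nbhs [opC1 rhsC1]] := kkt_near J hP hc ha.
have [U2 [f [U2nbhs fC1 fP]]] :=
  linear_solve_C1 U1nbhs (kkt_op_linear G J) opC1 rhsC1 inj.
have [oU2 U20] := U2nbhs.
pose F p := (usubmx (f p), dsubmx (f p)).
have FC1 : C1_on U2 F.
  by apply: (C1_pair oU2); [exact: C1_usubmx|exact: C1_dsubmx].
have F0 : F 0 = (x, l).
  (* The reference point solves the linear system at 0, whose only solution is [f 0]. *)
  have := (S_KKT_strict_active act).1 hKKT => /(fP _ U20).
  by rewrite /F => <-; rewrite col_mxKu col_mxKd.
have FX0 : \forall p \near (0 : param), X0 (F p).
  have FX : nbhs (F 0) X0 by rewrite F0.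
  exact: (C1_on_continuous FC1 U20) _ FX.
(* On [U] the point (p, F p) stays in the box [U0] x [X0], where strict activity makes the KKT
   conditions equivalent to the linear system. *)
pose U := [set p : param | [/\ U0 p, U2 p & X0 (F p)]]^°.
have UE p : U p -> [/\ U0 p, U2 p & X0 (F p)] by move/interior_subset.
exists U, X0, F; split => //.
- split; first exact: open_interior.
  have U2near : \forall p \near (0 : param), U2 p by exact: open_nbhs_nbhs.
  have U0near : \forall p \near (0 : param), U0 p by [].
  by apply: filterS3 U0near U2near FX0 => p.
- by apply: C1_onS FC1 => p /UE[].
- by move=> _ [p /UE[_ _ ?] <-].
(* A KKT point in the box solves the linear system, so uniqueness identifies it with [F p];
   conversely [F p] solves the system and lies in the box, hence is a KKT point. *)
apply/seteqP; split=> [[p [x' l']] /= [K [/[dup] Up /UE[U0p U2p _] X0xl']]|].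
  exists p => //; congr pair.
  have := (S_KKT_strict_active (U0X0 (p, (x', l')) (conj U0p X0xl'))).1 K.
  by move=> /(fP _ U2p); rewrite /F => <-; rewrite col_mxKu col_mxKd.
move=> _ [p /[dup] Up /UE[U0p U2p X0F] <-]; split=> //.
apply/(S_KKT_strict_active (U0X0 (p, F p) (conj U0p X0F))).
by apply/fP => //; rewrite vsubmxK.
Qed.
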